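(* Let $F$ be a field of characteristic $p\ge0$, $\delta\in F$, $r\ge1$ and $d\in\{r,r+\tfrac12\}$. The partition algebra $P_d(\delta)$ over $F$ is semisimple if and only if $\delta\notin\{2(d-r),2(d-r)+1,\dots,2(d-1)\}$, where this set of integers is considered as a subset of $\mathbb Z\cdot1_F\subseteq F$, and either $p=0$ or $p>r$.
   Context: $P_r(\delta)$ is the $F$-algebra with basis the set partitions (diagrams) of $\{1,\dots,r,1',\dots,r'\}$ (top row $1,\dots,r$, bottom row $1',\dots,r'$). The product of diagrams $a,b$: put $a$ on top of $b$, identify $i'$ of $a$ with $i$ of $b$; the result is the induced set partition on the top row of $a$ and bottom row of $b$, multiplied by $\delta^m$ where $m$ is the number of connected components meeting neither the top row of $a$ nor the bottom row of $b$. $P_{r+1/2}(\delta)\subset P_{r+1}(\delta)$ is the subalgebra spanned by the diagrams in which $r+1$ and $(r+1)'$ lie in the same block. The set in the claim is $\{0,1,\dots,2r-2\}$ if $d=r$ and $\{1,2,\dots,2r-1\}$ if $d=r+\frac12$. *)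

(* Defs.v *)
From HB Require Import structures.
From mathcomp Require Import all_boot all_algebra all_field.

Set Implicit Arguments.
Unset Strict Implicit.
Unset Printing Implicit Defensive.

Import GRing.Theory.

Section Diagrams.
Variable r : nat.

(* [inl i] is the top vertex $i$ and [inr i] the bottom vertex $i'$ *)
Definition vertex := ('I_r + 'I_r)%type.

Record diagram := Diagram {
  blocks : {set {set vertex}};
  _ : partition blocks [set: vertex]
}.

HB.instance Definition _ := [isSub for blocks].
HB.instance Definition _ := [Finite of diagram by <:].

Definition same_block (a : diagram) : rel vertex :=
  fun x y => y \in pblock (blocks a) x.

(* The three rows of vertices of [a] put on top of [b]: top of [a], middle,
   bottom of [b]. *)
Definition stack_vertex := ('I_r + 'I_r + 'I_r)%type.

Definition upper (x : vertex) : stack_vertex := inl x.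

Definition lower (x : vertex) : stack_vertex :=
  match x with inl i => inl (inr i) | inr i => inr i end.

Definition outer (x : vertex) : stack_vertex :=
  match x with inl i => inl (inl i) | inr i => inr i end.

Definition stack (a b : diagram) : rel stack_vertex := fun x y =>
  [exists B in [set upper @: B0 | B0 : {set vertex} in blocks a] :|:
               [set lower @: B0 | B0 : {set vertex} in blocks b],
    (x \in B) && (y \in B)].

Lemma same_blockP (a : diagram) x y :
  reflect (exists2 B, B \in blocks a & x \in B /\ y \in B) (same_block a x y).
Proof.
case: a => P /= partP; rewrite /same_block /=.
have /and3P[/eqP cP tP _] := partP.
apply: (iffP idP) => [yx|[B BP [xB yB]]]; last by rewrite (def_pblock tP BP xB).
have xP : x \in cover P by rewrite cP inE.
by exists (pblock P x); [exact: pblock_mem | rewrite mem_pblock xP].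
Qed.

Lemma same_block_equiv (a : diagram) : equivalence_rel (same_block a).
Proof.
case: a => P /= partP x y z; rewrite /same_block /=.
have /and3P[/eqP cP tP _] := partP.
rewrite mem_pblock cP inE; split=> // yx.
by rewrite (same_pblock tP yx).
Qed.

Lemma same_block_refl a : reflexive (same_block a).
Proof. by move=> x; case: (same_block_equiv a x x x). Qed.

Lemma same_block_sym a : symmetric (same_block a).
Proof.
suff H x y : same_block a x y -> same_block a y x by move=> x y; apply/idP/idP => /H.
by move=> xy; case: (same_block_equiv a x y x) => _ <- //; apply: same_block_refl.
Qed.

Lemma same_block_trans a : transitive (same_block a).
Proof. by move=> y x z xy yz; case: (same_block_equiv a x y z) => _ ->. Qed.

Lemma same_block_inj a b : same_block a =2 same_block b -> a = b.
Proof.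
case: a => P pP; case: b => Q pQ; rewrite /same_block /= => eqPQ; apply: val_inj => /=.
rewrite -(equivalence_partition_pblock pP) -(equivalence_partition_pblock pQ).
by apply: eq_imset => x; apply/setP=> y; rewrite !inE eqPQ.
Qed.

Definition link (T : finType) (f : vertex -> T) (a : diagram) : rel T :=
  fun x y => [exists u, exists v, [&& f u == x, f v == y & same_block a u v]].

Lemma linkP (T : finType) (f : vertex -> T) a x y :
  reflect (exists u v, [/\ f u = x, f v = y & same_block a u v]) (link f a x y).
Proof.
apply: (iffP existsP) => [[u /existsP[v /and3P[/eqP ? /eqP ? ?]]]|[u [v [<- <- ?]]]].
  by exists u, v.
by exists u; apply/existsP; exists v; rewrite !eqxx.
Qed.

Lemma link_sym (T : finType) (f : vertex -> T) a : symmetric (link f a).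
Proof.
by move=> x y; apply/linkP/linkP => -[u [v [? ? ?]]]; exists v, u; split=> //;
  rewrite same_block_sym.
Qed.

Lemma stackE a b : stack a b =2 relU (link upper a) (link lower b).
Proof.
move=> x y; rewrite /stack /=; apply/existsP/orP.
  case=> B /andP[/setUP[]/imsetP[B0 B0P ->] /andP[/imsetP[u ? ->] /imsetP[v ? ->]]];
    [left|right]; apply/linkP; exists u, v; split=> //; apply/same_blockP; by exists B0.
case=> /linkP[u [v [<- <- /same_blockP[B BP [uB vB]]]]].
  by exists (upper @: B); rewrite !inE !imset_f // orbT.
by exists (lower @: B); rewrite !inE !imset_f // !orbT.
Qed.

Lemma stack_sym a b : symmetric (stack a b).
Proof. by move=> x y; rewrite !stackE /= ![link _ _ y x]link_sym. Qed.

Lemma stack_csym a b : connect_sym (stack a b).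
Proof. exact/sym_connect_sym/stack_sym. Qed.

Lemma stack_equiv a b :
  {in [set: vertex] & &,
    equivalence_rel (fun x y => connect (stack a b) (outer x) (outer y))}.
Proof.
by move=> x y z _ _ _; split=> // xy; apply: (same_connect (@stack_csym a b) xy).
Qed.

Definition dcomp (a b : diagram) : diagram :=
  Diagram (equivalence_partitionP (@stack_equiv a b)).

(* the exponent of $\delta$: the number of connected components that meet
   neither the top row of [a] nor the bottom row of [b] *)
Definition dloops (a b : diagram) : nat :=
  n_comp (stack a b)
    [pred v | [forall w, ~~ connect (stack a b) v (outer w)]].

Definition column (x : vertex) : 'I_r := match x with inl i | inr i => i end.

Definition did : diagram :=
  Diagram (preim_partitionP column [set: vertex]).

Lemma same_block_dcomp a b x y :
  same_block (dcomp a b) x y = connect (stack a b) (outer x) (outer y).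
Proof.
rewrite /same_block /=.
by rewrite (pblock_equivalence_partition (@stack_equiv a b)) ?inE.
Qed.

Lemma same_block_did x y : same_block did x y = (column x == column y).
Proof.
rewrite /same_block /= /preim_partition pblock_equivalence_partition ?inE //.
by move=> u v w _ _ _; split=> // /eqP->.
Qed.

End Diagrams.

Section Gluing.
Variables (V1 V2 T1 T2 W : finType).
Variables (o1 : V1 -> T1) (o2 : V2 -> T2) (g : T1 -> W) (h : T2 -> W).
Variables (e1 : rel T1) (e2 : rel T2) (E1 E2 : rel W).
Hypotheses (inj_g : injective g) (inj_h : injective h).
Hypotheses (sym1 : symmetric e1) (sym2 : symmetric e2).
Hypotheses (symE1 : symmetric E1) (symE2 : symmetric E2).
Hypothesis E1P : forall x y,
  reflect (exists u v, [/\ g u = x, g v = y & e1 u v]) (E1 x y).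
Hypothesis E2P : forall x y, E2 x y ->
  exists u v, [/\ h u = x, h v = y & connect e2 u v].
Hypothesis e1_e2 : forall u v, connect E1 (h u) (h v) -> connect e2 u v.
Hypothesis e2_E : forall u v, e2 u v -> connect (relU E1 E2) (h u) (h v).
Hypothesis cover_gh : forall x, (x \in codom g) || (x \in codom h).
Hypothesis inner1 : forall u, (g u \in codom h) = (u \in codom o1).

Let E := relU E1 E2.
Let csym1 : connect_sym e1. Proof. exact: sym_connect_sym. Qed.
Let csym2 : connect_sym e2. Proof. exact: sym_connect_sym. Qed.
Let csymE : connect_sym E.
Proof. by apply: sym_connect_sym => x y; rewrite /E /= symE1 symE2. Qed.

Lemma connect_step (T : finType) (e : rel T) (P : T -> Prop) x y :
  connect e x y -> P x -> (forall u v, P u -> e u v -> P v) -> P y.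
Proof.
case/connectP=> p; elim: p x => [x _ -> //|z p IHp x /= /andP[xz pp] ly Px H].
exact: IHp pp ly (H _ _ Px xz) H.
Qed.

Lemma glue_connect2 u v : connect E (h u) (h v) = connect e2 u v.
Proof.
apply/idP/idP => [uv|uv].
  suff [w /e1_e2 wv uw] : exists2 w, connect E1 (h w) (h v) & connect e2 u w.
    exact: connect_trans uw wv.
  apply: (@connect_step _ _
    (fun x => exists2 w, connect E1 (h w) x & connect e2 u w) _ _ uv).
    by exists u.
  move=> x y [w wx uw] /orP[xy|/E2P[x' [y' [hx hy xy]]]].
    by exists w => //; apply: connect_trans wx (connect1 xy).
  exists y'; first by rewrite -hy.
  by apply: connect_trans uw (connect_trans _ xy); apply: e1_e2; rewrite hx.
apply: (@connect_step _ _ (fun z => connect E (h u) (h z)) _ _ uv) => // x y ux xy.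
exact: connect_trans ux (e2_E xy).
Qed.

Lemma glue_connect1 u v : connect e1 u v -> connect E (g u) (g v).
Proof.
move=> uv; apply: (@connect_step _ _ (fun z => connect E (g u) (g z)) _ _ uv) => // x y ux xy.
by apply: connect_trans ux (connect1 _); apply/orP; left; apply/E1P; exists x, y.
Qed.

Lemma glue_float u x : (forall w, ~~ connect e1 u (o1 w)) ->
  connect E (g u) x -> exists2 v, x = g v & connect e1 u v.
Proof.
move=> Fu ux; apply: (@connect_step _ _
  (fun x => exists2 v, x = g v & connect e1 u v) _ _ ux); first by exists u.
move=> _ z [v -> uv] /orP[/E1P[v1 [z1 [/inj_g-> <- vz]]]|/E2P[v1 [z1 [hv _ _]]]].
  by exists z1 => //; apply: connect_trans uv (connect1 vz).
have: v \in codom o1 by rewrite -inner1 -hv codom_f.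
by case/codomP=> w vw; have := Fu w; rewrite -vw uv.
Qed.

Lemma glue_n_comp :
  n_comp E [pred x | [forall w, ~~ connect E x (h (o2 w))]] =
  n_comp e1 [pred u | [forall w, ~~ connect e1 u (o1 w)]] +
  n_comp e2 [pred u | [forall w, ~~ connect e2 u (o2 w)]].
Proof.
pose R := [pred x | [exists t, connect E x (h t)]].
pose A := [pred x | [forall w, ~~ connect E x (h (o2 w))]].
have clR : closed E R.
  apply: intro_closed => // x y xy /existsP[t xt]; apply/existsP; exists t.
  by rewrite (same_connect csymE (y := x)) // csymE connect1.
have clA : closed E A.
  apply: intro_closed => // x y xy /forallP F; apply/forallP => t.
  by rewrite (same_connect csymE (y := x)) // csymE connect1.
have clRA : closed E [predI A & R].
  by move=> x y xy; have := clR x y xy; have := clA x y xy; rewrite !inE => -> ->.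
have clCR : closed E [predC R] by apply: predC_closed.
have gR u : (g u \notin R) = [forall w, ~~ connect e1 u (o1 w)].
  apply/idP/idP => [/existsPn F|/forallP F].
    apply/forallP=> w; apply/negP => uw.
    have /codomP[t gt] : g (o1 w) \in codom h by rewrite inner1 codom_f.
    by case/negP: (F t); rewrite -gt; apply: glue_connect1.
  apply/existsPn=> t; apply/negP => /(glue_float F)[v hv uv].
  have: v \in codom o1 by rewrite -inner1 -hv codom_f.
  by case/codomP=> w vw; have := F w; rewrite -vw uv.
have -> : n_comp E A = n_comp E [predC R] + n_comp E [predI A & R].
  rewrite /n_comp_mem addnC -(cardID R (predI _ A)); congr (_ + _).
    by apply: eq_card => x; rewrite !inE andbA.
  apply: eq_card => x; rewrite !inE; case: existsP => [_|nR]; first by rewrite andbF.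
  suff -> : [forall w, ~~ connect E x (h (o2 w))] by rewrite !andbT.
  by apply/forallP => w; apply/negP => xw; case: nR; exists (o2 w).
congr (_ + _).
  rewrite (@adjunction_n_comp _ _ g E e1 csymE csym1 [predC R]) //.
    by apply: eq_n_comp_r => u; rewrite !inE -gR.
  split=> [x xR|u v uR].
    apply: sigW; suff /codomP[u ->] : x \in codom g by exists u.
    have := cover_gh x; case: (boolP (x \in codom h)) => [/codomP[t xt]|]; last by rewrite orbF.
    by case/negP: xR; apply/existsP; exists t; rewrite xt.
  have /forallP F : [forall w, ~~ connect e1 u (o1 w)] by rewrite -gR.
  by apply/idP/idP => [|/(glue_float F)[w /inj_g ->]]; first exact: glue_connect1.
rewrite (@adjunction_n_comp _ _ h E e2 csymE csym2 [predI A & R]) //.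
  apply: eq_n_comp_r => u; rewrite !inE andbC.
  have -> : [exists t, connect E (h u) (h t)] by apply/existsP; exists u.
  by apply: eq_forallb => w; rewrite glue_connect2.
split=> [x /andP[_ xR]|u v _]; last by rewrite glue_connect2.
by apply: sigW; apply/existsP.
Qed.

End Gluing.

Section DiagramMonoid.
Variable r : nat.
Implicit Types (a b c : diagram r).

Let row4 := ('I_r + 'I_r + 'I_r + 'I_r)%type.
Let g12 (x : stack_vertex r) : row4 := inl x.
Let g234 (x : stack_vertex r) : row4 :=
  match x with
  | inl (inl i) => inl (inl (inr i))
  | inl (inr i) => inl (inr i)
  | inr i => inr i
  end.
Let h134 (x : stack_vertex r) : row4 :=
  match x with
  | inl (inl i) => inl (inl (inl i))
  | inl (inr i) => inl (inr i)
  | inr i => inr i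
  end.
Let h124 (x : stack_vertex r) : row4 :=
  match x with
  | inl (inl i) => inl (inl (inl i))
  | inl (inr i) => inl (inl (inr i))
  | inr i => inr i
  end.
Lemma upper_inj : injective (@upper r). Proof. by move=> x y []. Qed.
Lemma lower_inj : injective (@lower r).
Proof. by move=> [x|x] [y|y] // []->. Qed.
Lemma outer_inj : injective (@outer r).
Proof. by move=> [x|x] [y|y] // []->. Qed.
Let g12_inj : injective g12. Proof. by move=> x y []. Qed.
Let g234_inj : injective g234.
Proof. by move=> [[x|x]|x] [[y|y]|y] // []->. Qed.
Let h134_inj : injective h134.
Proof. by move=> [[x|x]|x] [[y|y]|y] // []->. Qed.
Let h124_inj : injective h124.
Proof. by move=> [[x|x]|x] [[y|y]|y] // []->. Qed.

Let LA a : rel row4 := link (g12 \o @upper r) a.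
Let LB b : rel row4 := link (g12 \o @lower r) b.
Let LC c : rel row4 := link (g234 \o @lower r) c.

Let g234_upper z : g234 (upper z) = g12 (lower z). Proof. by case: z. Qed.
Let h134_upper z : h134 (upper z) = g12 (outer z). Proof. by case: z. Qed.
Let h134_lower z : h134 (lower z) = g234 (lower z). Proof. by case: z. Qed.
Let h124_upper z : h124 (upper z) = g12 (upper z). Proof. by case: z. Qed.
Let h124_lower z : h124 (lower z) = g234 (outer z). Proof. by case: z. Qed.
Let h124_outer z : h124 (outer z) = h134 (outer z). Proof. by case: z. Qed.

Let E12P a b x y : reflect (exists u v, [/\ g12 u = x, g12 v = y & stack a b u v])
  (relU (LA a) (LB b) x y).
Proof.
apply: (iffP orP) => [[]/linkP[u [v [<- <- uv]]]|[u [v [<- <- ]]]].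
- exists (upper u), (upper v); split=> //; rewrite stackE; apply/orP; left.
  by apply/linkP; exists u, v.
- exists (lower u), (lower v); split=> //; rewrite stackE; apply/orP; right.
  by apply/linkP; exists u, v.
by rewrite stackE => /orP[]/linkP[x' [y' [<- <- xy]]]; [left|right];
  apply/linkP; exists x', y'.
Qed.

Let E23P b c x y :
  reflect (exists u v, [/\ g234 u = x, g234 v = y & stack b c u v])
  (relU (LB b) (LC c) x y).
Proof.
apply: (iffP orP) => [[]/linkP[u [v [<- <- uv]]]|[u [v [<- <- ]]]].
- exists (upper u), (upper v); rewrite !g234_upper; split=> //.
  by rewrite stackE; apply/orP; left; apply/linkP; exists u, v.
- exists (lower u), (lower v); split=> //; rewrite stackE; apply/orP; right.
  by apply/linkP; exists u, v.
by rewrite stackE => /orP[]/linkP[x' [y' [<- <- xy]]]; [left|right];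
  apply/linkP; exists x', y'; rewrite ?g234_upper.
Qed.

Let connect_im (T W : finType) (g : T -> W) (e : rel T) (E : rel W) u x :
  injective g ->
  (forall x y, reflect (exists u v, [/\ g u = x, g v = y & e u v]) (E x y)) ->
  connect E (g u) x -> exists2 v, x = g v & connect e u v.
Proof.
move=> inj_g EP ux; apply: (@connect_step _ _
  (fun x => exists2 v, x = g v & connect e u v) _ _ ux); first by exists u.
move=> _ z [v -> uv] /EP[v1 [z1 [/inj_g-> <- vz]]].
by exists z1 => //; apply: connect_trans uv (connect1 vz).
Qed.

Let connect_out (T W : finType) (g : T -> W) (e : rel T) (E : rel W) x y :
  (forall x y, reflect (exists u v, [/\ g u = x, g v = y & e u v]) (E x y)) ->
  x \notin codom g -> connect E x y -> y = x.
Proof.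
move=> EP gx xy; apply: (@connect_step _ _ (fun z => z = x) _ _ xy) => // u v ->.
by case/EP => u' [_ [ux _ _]]; case/negP: gx; rewrite -ux codom_f.
Qed.

Let connect_hom (T W : finType) (g : T -> W) (e : rel T) (E : rel W) :
  (forall u v, e u v -> connect E (g u) (g v)) ->
  forall u v, connect e u v -> connect E (g u) (g v).
Proof.
move=> H u v uv; apply: (@connect_step _ _ (fun z => connect E (g u) (g z)) _ _ uv) => //.
by move=> x y ux /H; apply: connect_trans.
Qed.

Let full a b c := relU (relU (LA a) (LB b)) (LC c).

Let left_glue a b c :
  (forall u v, connect (full a b c) (h134 u) (h134 v) =
               connect (stack (dcomp a b) c) u v) /\
  n_comp (full a b c)
    [pred x | [forall w, ~~ connect (full a b c) x (h134 (outer w))]] =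
  dloops a b + dloops (dcomp a b) c.
Proof.
have E2P x y : LC c x y ->
    exists u v, [/\ h134 u = x, h134 v = y & connect (stack (dcomp a b) c) u v].
  case/linkP=> u [v [<- <- uv]]; exists (lower u), (lower v).
  rewrite !h134_lower; split=> //.
  by apply: connect1; rewrite stackE; apply/orP; right; apply/linkP; exists u, v.
have hg t z : h134 t = g12 z -> exists x, t = upper x.
  by case: t => [x|x] //; exists x.
have e1_e2 u v : connect (relU (LA a) (LB b)) (h134 u) (h134 v) ->
    connect (stack (dcomp a b) c) u v.
  case: (boolP (h134 u \in codom g12)) => [/codomP[z hz]|hu]; last first.
    by move/(connect_out (E12P a b) hu)/h134_inj ->.
  have [x ->] := hg _ _ hz; rewrite h134_upper.
  move=> /(connect_im g12_inj (E12P a b))[z' hz'].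
  have [y vy] := hg _ _ hz'; move: hz'; rewrite vy h134_upper => /g12_inj<- xy.
  apply: connect1; rewrite stackE; apply/orP; left; apply/linkP; exists x, y.
  by rewrite same_block_dcomp.
have e2_E u v : stack (dcomp a b) c u v ->
    connect (relU (relU (LA a) (LB b)) (LC c)) (h134 u) (h134 v).
  rewrite stackE => /orP[]/linkP[x [y [<- <-]]].
    rewrite same_block_dcomp !h134_upper.
    apply: connect_hom => x' y' xy; apply: connect1; apply/orP; left.
    by apply/E12P; exists x', y'.
  move=> xy; apply: connect1; apply/orP; right; apply/linkP; exists x, y.
  by rewrite !h134_lower.
have cov x : (x \in codom g12) || (x \in codom h134).
  case: x => [x|i]; apply/orP; [left|right]; apply/codomP; first by exists x.
  by exists (inr i).
have inner u : (g12 u \in codom h134) = (u \in codom (@outer r)).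
  apply/codomP/codomP => [[[[x|x]|x]] // []->|[[x|x] ->]].
  - by exists (inl x).
  - by exists (inr x).
  - by exists (inl (inl x)).
  - by exists (inl (inr x)).
have sE1 : symmetric (relU (LA a) (LB b)).
  by move=> x y; rewrite /= /LA /LB ![link _ _ y x]link_sym.
have sE2 : symmetric (LC c) by apply: link_sym.
split; first exact: (glue_connect2 E2P e1_e2 e2_E).
exact: (glue_n_comp _ g12_inj (@stack_sym r a b)
  (@stack_sym r _ c) sE1 sE2 (E12P a b) E2P e1_e2 e2_E cov inner).
Qed.

Let right_glue a b c :
  (forall u v, connect (full a b c) (h124 u) (h124 v) =
               connect (stack a (dcomp b c)) u v) /\
  n_comp (full a b c)
    [pred x | [forall w, ~~ connect (full a b c) x (h124 (outer w))]] =
  dloops b c + dloops a (dcomp b c).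
Proof.
have fullE : full a b c =2 relU (relU (LB b) (LC c)) (LA a).
  by move=> x y; rewrite /full /= -orbA orbC.
have cfullE := eq_connect fullE.
have -> : n_comp (full a b c)
    [pred x | [forall w, ~~ connect (full a b c) x (h124 (outer w))]] =
  n_comp (relU (relU (LB b) (LC c)) (LA a)) [pred x | [forall w,
    ~~ connect (relU (relU (LB b) (LC c)) (LA a)) x (h124 (outer w))]].
  etransitivity; first exact: (eq_n_comp cfullE (mem _)).
  apply: eq_n_comp_r => x.
  exact: (eq_forallb (fun w => congr1 negb (cfullE x (h124 (outer w))))).
have E2P x y : LA a x y ->
    exists u v, [/\ h124 u = x, h124 v = y & connect (stack a (dcomp b c)) u v].
  case/linkP=> u [v [<- <- uv]]; exists (upper u), (upper v).
  rewrite !h124_upper; split=> //.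
  by apply: connect1; rewrite stackE; apply/orP; left; apply/linkP; exists u, v.
have hg t z : h124 t = g234 z -> exists x, t = lower x.
  case: t => [[x|x]|x] //.
  - by case: z => [[z|z]|z].
  - by exists (inl x).
  - by exists (inr x).
have e1_e2 u v : connect (relU (LB b) (LC c)) (h124 u) (h124 v) ->
    connect (stack a (dcomp b c)) u v.
  case: (boolP (h124 u \in codom g234)) => [/codomP[z hz]|hu]; last first.
    by move/(connect_out (E23P b c) hu)/h124_inj ->.
  have [x ->] := hg _ _ hz; rewrite h124_lower.
  move=> /(connect_im g234_inj (E23P b c))[z' hz'].
  have [y vy] := hg _ _ hz'; move: hz'; rewrite vy h124_lower => /g234_inj<- xy.
  apply: connect1; rewrite stackE; apply/orP; right; apply/linkP; exists x, y.
  by rewrite same_block_dcomp.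
have e2_E u v : stack a (dcomp b c) u v ->
    connect (relU (relU (LB b) (LC c)) (LA a)) (h124 u) (h124 v).
  rewrite stackE => /orP[]/linkP[x [y [<- <-]]]; last first.
    rewrite same_block_dcomp !h124_lower.
    apply: connect_hom => x' y' xy; apply: connect1; apply/orP; left.
    by apply/E23P; exists x', y'.
  move=> xy; apply: connect1; apply/orP; right; apply/linkP; exists x, y.
  by rewrite !h124_upper.
have cov x : (x \in codom g234) || (x \in codom h124).
  apply/orP; case: x => [[[i|i]|i]|i].
  - by right; apply/codomP; exists (inl (inl i)).
  - by left; apply/codomP; exists (inl (inl i)).
  - by left; apply/codomP; exists (inl (inr i)).
  - by left; apply/codomP; exists (inr i).
have inner u : (g234 u \in codom h124) = (u \in codom (@outer r)).
  apply/codomP/codomP => [[t]|[t ->]]; last by exists (lower t); rewrite h124_lower.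
  move=> hz; have [x tx] := hg _ _ (esym hz); exists x.
  by move: hz; rewrite tx h124_lower => /g234_inj.
have sE1 : symmetric (relU (LB b) (LC c)).
  by move=> x y; rewrite /= /LB /LC ![link _ _ y x]link_sym.
have sE2 : symmetric (LA a) by apply: link_sym.
split; first by move=> u v; rewrite cfullE; apply: (glue_connect2 E2P e1_e2 e2_E).
exact: (glue_n_comp _ g234_inj (@stack_sym r b c)
  (@stack_sym r a _) sE1 sE2 (E23P b c) E2P e1_e2 e2_E cov inner).
Qed.

Lemma dcompA : associative (@dcomp r).
Proof.
move=> a b c; apply: same_block_inj => x y; rewrite !same_block_dcomp.
have [<- _] := left_glue a b c; have [<- _] := right_glue a b c.
by rewrite !h124_outer.
Qed.

Lemma dloopsA a b c :
  dloops a b + dloops (dcomp a b) c = dloops b c + dloops a (dcomp b c).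
Proof.
have [_ eql] := left_glue a b c; have [_ eqr] := right_glue a b c.
apply: etrans (esym eql) (etrans _ eqr); apply: eq_n_comp_r => x; apply: eq_forallb => w; congr (~~ connect _ _ _).
by rewrite h124_outer.
Qed.

Lemma did_upper_lower a i :
  connect (stack (did r) a) (inl (inl i)) (inl (inr i)).
Proof.
apply: connect1; rewrite stackE; apply/orP; left; apply/linkP.
by exists (inl i), (inr i); rewrite same_block_did.
Qed.

Lemma dcomp1d : left_id (did r) (@dcomp r).
Proof.
move=> a; apply: same_block_inj => x y; rewrite same_block_dcomp.
have lo z : connect (stack (did r) a) (outer z) (lower z).
  by case: z => [i|i]; [apply: did_upper_lower | apply: connect0].
pose p (z : stack_vertex r) : vertex r :=
  match z with inl (inl i) | inl (inr i) => inl i | inr i => inr i end.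
have po z : p (outer z) = z by case: z.
have pl z : p (lower z) = z by case: z.
apply/idP/idP => [xy|xy].
  suff: same_block a x (p (outer y)) by rewrite po.
  apply: (@connect_step _ _ (fun z => same_block a x (p z)) _ _ xy).
    by rewrite po same_block_refl.
  move=> u v xu; rewrite stackE => /orP[]/linkP[u' [v' [uu vv]]]; last first.
    by rewrite -uu -vv in xu *; rewrite !pl in xu *; apply: same_block_trans.
  rewrite same_block_did => /eqP uv; suff -> : p v = p u by [].
  by rewrite -uu -vv; case: u' uv {uu} => i; case: v' {vv} => j /= ->.
apply: connect_trans (lo x) _; rewrite stack_csym.
apply: connect_trans (lo y) _; rewrite stack_csym; apply: connect1.
by rewrite stackE; apply/orP; right; apply/linkP; exists x, y.
Qed.

Lemma dloops1d a : dloops (did r) a = 0.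
Proof.
apply: eq_card0 => x; rewrite !inE; apply/negP => /andP[_ /forallP H].
case: x H => [[i|i]|i] H.
- by have := H (inl i); rewrite connect0.
- by have := H (inl i); rewrite stack_csym did_upper_lower.
- by have := H (inr i); rewrite connect0.
Qed.

Lemma did_lower_upper a i :
  connect (stack a (did r)) (inl (inr i)) (inr i).
Proof.
apply: connect1; rewrite stackE; apply/orP; right; apply/linkP.
by exists (inl i), (inr i); rewrite same_block_did.
Qed.

Lemma dcompd1 : right_id (did r) (@dcomp r).
Proof.
move=> a; apply: same_block_inj => x y; rewrite same_block_dcomp.
have up z : connect (stack a (did r)) (upper z) (outer z).
  by case: z => [i|i]; [apply: connect0 | apply: did_lower_upper].
pose p (z : stack_vertex r) : vertex r :=
  match z with inl (inl i) => inl i | inl (inr i) | inr i => inr i end.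
have po z : p (outer z) = z by case: z.
have pu z : p (upper z) = z by case: z.
apply/idP/idP => [xy|xy].
  suff: same_block a x (p (outer y)) by rewrite po.
  apply: (@connect_step _ _ (fun z => same_block a x (p z)) _ _ xy).
    by rewrite po same_block_refl.
  move=> u v xu; rewrite stackE => /orP[]/linkP[u' [v' [uu vv]]].
    by rewrite -uu -vv in xu *; rewrite !pu in xu *; apply: same_block_trans.
  rewrite same_block_did => /eqP uv; suff -> : p v = p u by [].
  by rewrite -uu -vv; case: u' uv {uu} => i; case: v' {vv} => j /= ->.
apply: connect_trans (up y); rewrite stack_csym.
apply: connect_trans (up x); rewrite stack_csym; apply: connect1.
by rewrite stackE; apply/orP; left; apply/linkP; exists x, y.
Qed.

Lemma dloopsd1 a : dloops a (did r) = 0.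
Proof.
apply: eq_card0 => x; rewrite !inE; apply/negP => /andP[_ /forallP H].
case: x H => [[i|i]|i] H.
- by have := H (inl i); rewrite connect0.
- by have := H (inr i); rewrite did_lower_upper.
- by have := H (inr i); rewrite connect0.
Qed.

End DiagramMonoid.

Local Open Scope ring_scope.

(* The product extending bilinearly the products [m a b] of the basis
   vectors [e a] and [e b], [x a] being the coordinate along [e a] *)
Section BilinearExtension.
Variables (K : fieldType) (I : finType) (V : lmodType K).
Variables (x : I -> V -> K) (e : I -> V) (m : I -> I -> V).
Hypothesis xD : forall i u v, x i (u + v) = x i u + x i v.
Hypothesis xZ : forall i k u, x i (k *: u) = k * x i u.
Hypothesis xe : forall i j, x i (e j) = (i == j)%:R.
Hypothesis x_sum : forall u, u = \sum_i x i u *: e i.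

Definition bilin (u v : V) : V := \sum_a \sum_b (x a u * x b v) *: m a b.

Lemma bilinDl : left_distributive bilin +%R.
Proof.
move=> f1 f2 g; rewrite /bilin -big_split; apply: eq_bigr => a _ /=.
by rewrite -big_split; apply: eq_bigr => b _ /=; rewrite -scalerDl xD mulrDl.
Qed.

Lemma bilinDr : right_distributive bilin +%R.
Proof.
move=> f g1 g2; rewrite /bilin -big_split; apply: eq_bigr => a _ /=.
by rewrite -big_split; apply: eq_bigr => b _ /=; rewrite -scalerDl xD mulrDr.
Qed.

Lemma bilinZl k f g : k *: bilin f g = bilin (k *: f) g.
Proof.
rewrite /bilin scaler_sumr; apply: eq_bigr => a _.
by rewrite scaler_sumr; apply: eq_bigr => b _; rewrite scalerA xZ mulrA.
Qed.

Lemma bilinZr k f g : k *: bilin f g = bilin f (k *: g).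
Proof.
rewrite /bilin scaler_sumr; apply: eq_bigr => a _.
by rewrite scaler_sumr; apply: eq_bigr => b _; rewrite scalerA xZ mulrCA.
Qed.

Lemma bilin_suml (f : I -> V) g : bilin (\sum_i f i) g = \sum_i bilin (f i) g.
Proof.
apply: (big_morph (bilin^~ g) (fun x y => bilinDl x y g)).
by apply: (addIr (bilin 0 g)); rewrite -bilinDl !add0r.
Qed.

Lemma bilin_sumr (g : I -> V) f : bilin f (\sum_i g i) = \sum_i bilin f (g i).
Proof.
apply: (big_morph (bilin f) (bilinDr f)).
by apply: (addIr (bilin f 0)); rewrite -bilinDr !add0r.
Qed.

Lemma bilin_basis a b : bilin (e a) (e b) = m a b.
Proof.
rewrite /bilin (bigD1 a) //= (bigD1 b) //= !xe !eqxx mul1r scale1r.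
rewrite !big1 ?addr0 // => [a' na|b' nb].
  by apply: big1 => b' _; rewrite xe (negbTE na) mul0r scale0r.
by rewrite xe (negbTE nb) mulr0 scale0r.
Qed.

Lemma bilinA :
  (forall a b c, bilin (e a) (m b c) = bilin (m a b) (e c)) -> associative bilin.
Proof.
move: bilin bilin_suml bilin_sumr bilinZl bilinZr bilin_basis.
move=> mul suml sumr Zl Zr mul_e mA f g h; rewrite (x_sum f) (x_sum g) (x_sum h).
rewrite !suml; apply: eq_bigr => a _.
rewrite !(sumr _ (x a f *: _)) suml; apply: eq_bigr => b _.
rewrite !sumr; apply: eq_bigr => c _.
rewrite -!Zl -!Zr -!Zl !mul_e mA !scalerA.
by congr (_ *: _); apply: mulrAC.
Qed.

Lemma bilinA_op (op : I -> I -> I) (s : I -> I -> K) :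
    (forall a b, m a b = s a b *: e (op a b)) -> associative op ->
    (forall a b c, s a b * s (op a b) c = s b c * s a (op b c)) ->
  associative bilin.
Proof.
move=> mE opA sA; apply: bilinA => a b c.
rewrite [m b c]mE [m a b]mE -bilinZr -bilinZl !bilin_basis !mE.
by rewrite !scalerA sA opA.
Qed.

Lemma bilin1l i : (forall a, m i a = e a) -> left_id (e i) bilin.
Proof.
move=> mi u; rewrite {1}(x_sum u) bilin_sumr [RHS]x_sum.
by apply: eq_bigr => a _; rewrite -bilinZr bilin_basis mi.
Qed.

Lemma bilin1r i : (forall a, m a i = e a) -> right_id (e i) bilin.
Proof.
move=> mi u; rewrite {1}(x_sum u) bilin_suml [RHS]x_sum.
by apply: eq_bigr => a _; rewrite -bilinZl bilin_basis mi.
Qed.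

End BilinearExtension.

(* $P_r(\delta)$; an element is its family of coordinates in the diagram
   basis *)
Definition partition_algebra (F : fieldType) (delta : F) (r : nat) : Type :=
  {ffun diagram r -> F^o}.

Section PartitionAlgebra.
Variables (F : fieldType) (delta : F) (r : nat).
Local Notation P := (partition_algebra delta r).

HB.instance Definition _ := Vector.copy P {ffun diagram r -> F^o}.

Definition diagram_vect (a : diagram r) : P := [ffun b => (b == a)%:R].

Let coord (a : diagram r) (f : P) : F := f a.
Let dmul (a b : diagram r) : P := delta ^+ dloops a b *: diagram_vect (dcomp a b).

Definition pmul (f g : P) : P :=
  \sum_a \sum_b (f a * g b) *: (delta ^+ dloops a b *: diagram_vect (dcomp a b)).

Let coordD a (f g : P) : coord a (f + g) = coord a f + coord a g.
Proof. exact: ffunE. Qed.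
Let coordZ a k (f : P) : coord a (k *: f) = k * coord a f.
Proof. exact: ffunE. Qed.
Let coord_vect a b : coord a (diagram_vect b) = (a == b)%:R.
Proof. exact: ffunE. Qed.

Lemma diagram_vect_sum (f : P) : f = \sum_a f a *: diagram_vect a.
Proof.
apply/ffunP => b; rewrite sum_ffunE (bigD1 b) //= big1 ?addr0 => [|a nab].
  by rewrite !ffunE eqxx; symmetry; apply: mulr1.
by rewrite !ffunE eq_sym (negbTE nab); apply: mulr0.
Qed.

Lemma pmulDl : left_distributive pmul +%R.
Proof. exact: (bilinDl dmul coordD). Qed.

Lemma pmulDr : right_distributive pmul +%R.
Proof. exact: (bilinDr dmul coordD). Qed.

Lemma pmulZl k f g : k *: pmul f g = pmul (k *: f) g.
Proof. exact: (bilinZl dmul coordZ). Qed.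

Lemma pmulZr k f g : k *: pmul f g = pmul f (k *: g).
Proof. exact: (bilinZr dmul coordZ). Qed.

Lemma pmul_vect a b : pmul (diagram_vect a) (diagram_vect b) = dmul a b.
Proof. exact: (bilin_basis dmul coord_vect). Qed.

Lemma pmulA : associative pmul.
Proof.
apply: (@bilinA_op _ _ _ _ _ dmul coordD coordZ coord_vect diagram_vect_sum
  (@dcomp r) (fun a b => delta ^+ dloops a b) (fun _ _ => erefl) (@dcompA r)).
move=> a b c; refine (etrans (esym (exprD _ _ _)) (etrans _ (exprD _ _ _))).
exact: (congr1 (GRing.exp delta) (dloopsA a b c)).
Qed.

Lemma pmul1l : left_id (diagram_vect (did r)) pmul.
Proof.
apply: (bilin1l coordD coordZ coord_vect diagram_vect_sum (m := dmul)) => a.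
by rewrite /dmul dcomp1d dloops1d scale1r.
Qed.

Lemma pmul1r : right_id (diagram_vect (did r)) pmul.
Proof.
apply: (bilin1r coordD coordZ coord_vect diagram_vect_sum (m := dmul)) => a.
by rewrite /dmul dcompd1 dloopsd1 scale1r.
Qed.

Lemma pone_neq0 : diagram_vect (did r) != 0.
Proof.
by apply/eqP => /ffunP/(_ (did r))/eqP; rewrite !ffunE eqxx oner_eq0.
Qed.

HB.instance Definition _ :=
  GRing.Zmodule_isNzRing.Build P pmulA pmul1l pmul1r pmulDl pmulDr pone_neq0.
HB.instance Definition _ := GRing.Lmodule_isLalgebra.Build F P pmulZl.
HB.instance Definition _ := GRing.Lalgebra_isAlgebra.Build F P pmulZr.
HB.instance Definition _ := Algebra_isFalgebra.Build F P.

Lemma mul_diagram_vect a b :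
  diagram_vect a * diagram_vect b =
  delta ^+ dloops a b *: diagram_vect (dcomp a b).
Proof. exact: pmul_vect. Qed.

End PartitionAlgebra.

Section HalfPartitionAlgebra.
Variables (F : fieldType) (delta : F) (r : nat).

Definition half_diagram (a : diagram r.+1) : bool :=
  same_block a (inl ord_max) (inr ord_max).

Definition half_span : {vspace partition_algebra delta r.+1} :=
  <<[seq diagram_vect delta a | a in half_diagram]>>%VS.

Lemma half_diagram_did : half_diagram (did r.+1).
Proof. by rewrite /half_diagram same_block_did. Qed.

Lemma half_diagram_dcomp a b :
  half_diagram a -> half_diagram b -> half_diagram (dcomp a b).
Proof.
move=> ha hb; rewrite /half_diagram same_block_dcomp.
apply: (@connect_trans _ _ (inl (inr ord_max))); apply: connect1;
  rewrite stackE; apply/orP; [left|right]; apply/linkP.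
  by exists (inl ord_max), (inr ord_max).
by exists (inl ord_max), (inr ord_max).
Qed.

Lemma mem_half_span a : half_diagram a -> diagram_vect delta a \in half_span.
Proof. by move=> ha; apply/memv_span/imageP; exists a. Qed.

Fact half_span_is_aspace : is_aspace half_span.
Proof.
rewrite /is_aspace has_algid1; last exact: (mem_half_span half_diagram_did).
apply/prodvP => u v /coord_span-> /coord_span->.
rewrite mulr_suml rpred_sum // => i _; rewrite mulr_sumr rpred_sum // => j _.
rewrite -scalerAl -scalerAr !rpredZ //.
have nthP n : (n < #|half_diagram|)%N -> exists2 a, half_diagram a &
    [seq diagram_vect delta a | a in half_diagram]`_n = diagram_vect delta a.
  by move=> ltn; apply/imageP/mem_nth; rewrite size_image.
have [a ha ->] := nthP _ (ltn_ord i); have [b hb ->] := nthP _ (ltn_ord j).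
by rewrite mul_diagram_vect rpredZ // mem_half_span // half_diagram_dcomp.
Qed.

(* $P_{r+1/2}(\delta)$ *)
Definition half_partition_algebra : {aspace partition_algebra delta r.+1} :=
  ASpace half_span_is_aspace.

(* $P_d(\delta)$ for $d = r$ ([half = false]) or $d = r + 1/2$
   ([half = true]) *)
Definition partition_algebra_at (half : bool) : falgType F :=
  if half then (subvs_of half_partition_algebra : falgType F)
  else (partition_algebra delta r : falgType F).

End HalfPartitionAlgebra.

(* [p] is the characteristic of [F], which is 0 when [[pchar F]], the set of
   primes that vanish in [F], is empty *)
Definition has_characteristic (F : fieldType) (p : nat) : Prop :=
  if p == 0%N then [pchar F] =i pred0 else p \in [pchar F].

Definition left_ideal (F : fieldType) (A : falgType F) (I : {vspace A}) : bool :=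
  (fullv * I <= I)%VS.

(* The left regular module is semisimple: every submodule is a direct
   summand. *)
Definition semisimple (F : fieldType) (A : falgType F) : Prop :=
  forall I : {vspace A}, left_ideal I ->
  exists J : {vspace A},
    [/\ left_ideal J, (I + J)%VS = fullv & (I :&: J)%VS = 0%VS].

(* Main.v *)
Require Import Defs.
From mathcomp Require Import all_boot all_fingroup all_algebra all_field zify.
From Stdlib Require Import Classical.

(** Both algebras are treated at once.  For [h : bool], let A be the span of the
    diagrams of rank N satisfying [half_if h]: all diagrams when h is false, and
    those with the last column inside one block when h is true.  So N = r + h.
    For a finite-dimensional algebra, semisimplicity is von Neumann regularity:
    every z has a y with z y z = z ([semisimple_regular]).  In this form it
    passes to corners e A e by inspection, and one nonzero z with z A z = 0
    refutes it.

    The trace form.  Sending a diagram to delta^(c - 1), where c is the number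
    of components left after joining each i with i', defines a trace, and
    tr(a b) = delta^(|a v b*| - 1), where b* is b upside down and v is the join of
    set partitions ([ptrace_mul_vect]).  Sorting the colourings of the vertices
    by the partition that they induce expresses x^|p| as the sum over s coarser
    than p of x (x - 1) ... (x - |s| + 1) ([ffact_join], [expr_join]).  Hence
    Moebius inversion over the partition lattice diagonalises the Gram matrix,
    with entries (delta - 1) ... (delta - |s| + 1).  Only the finest diagram has
    2N - h blocks, so if delta avoids 1, ..., 2N - 2 - h the radical of the form is
    at most a line, and a vector spanning that line has a nonzero coefficient on the
    identity diagram.  Therefore the form is nondegenerate on the span J of
    the diagrams that are not permutations ([trace_nondegenerate]).

    Sufficiency is an induction on N.  Let e be the diagram obtained from the
    identity by joining the last two columns.  Then e A e is the algebra of
    rank N - 1 ([corner_regular]), J = A e A ([nonperm_BeB]), and A / J is the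
    group algebra of a symmetric group of degree r, to which Maschke's
    averaging applies when r! is nonzero.  An algebra whose corner e A e and
    quotient by A e A are both regular need not be regular, but it is as soon as
    some trace form is nondegenerate on A e A ([regular_extension]).  In rank one
    the idempotent is p / delta, with p the diagram without edges, which explains
    the exclusion of delta = 0 when h is false ([regular_rank1]).

    Necessity.  If r! vanishes in F, the sum s of all permutation diagrams is
    outside J, although s A s is contained in J ([not_regular_fact]).  If
    delta = k, regularity in rank N implies regularity in lower ranks, so one may
    assume k = N - 1 + t with 0 <= t < N - h.  Choose t bottom vertices besides
    the N top ones, and let z be the alternating sum, over the permutations g of
    these N + t vertices, of the diagrams whose blocks are the orbits of g.
    By Moebius inversion this encodes the condition that the N + t labels be
    distinct.  A diagram joining two of its bottom vertices i' and j' kills z,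
    because g and g (i j) then contribute opposite terms.  A diagram with an
    isolated bottom vertex kills z too: the matching top vertex of the second
    factor is either fixed by g, which yields a loop and a factor delta, or
    inserted in a cycle after one of the other N + t - 1 points, which yields a
    sign, and delta - (N + t - 1) = 0.  Hence J z = 0; as z lies in J, z A z = 0
    ([not_regular_delta]). *)

Set Implicit Arguments.
Unset Strict Implicit.
Unset Printing Implicit Defensive.

Import GRing.Theory.
Local Open Scope ring_scope.

(** * Semisimplicity as von Neumann regularity *)

Section RingTheory.
Variables (F : fieldType) (A : falgType F).
Implicit Types (B I J K : {vspace A}) (u v w x y z e : A).

Definition regular_in B := {in B, forall z, exists2 y, y \in B & z * y * z = z}.

Definition annihilated_by I w : {vspace A} := (I :&: lker (amulr w))%VS.

Lemma mem_annihilated_by I w x : (x \in annihilated_by I w) = (x \in I) && (x * w == 0).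
Proof. by rewrite memv_cap memv_ker lfunE. Qed.

Definition no_idempotent K := {in K, forall v, v * v = v -> v = 0}.

(** If w is not maximal, a nonzero idempotent v of I with v w = 0 gives the larger
    idempotent w + v - w v, whose annihilator in I is strictly smaller. *)
Lemma max_idempotent I : {in I &, forall x y, x * y \in I} ->
  exists w, [/\ w \in I, w * w = w & no_idempotent (annihilated_by I w)].
Proof.
move=> closedI.
suff H m w : w \in I -> w * w = w -> (\dim (annihilated_by I w) <= m)%N ->
    exists w, [/\ w \in I, w * w = w & no_idempotent (annihilated_by I w)].
  exact: (H _ 0 (mem0v _) (mul0r _) (leqnn _)).
elim: m w => [|m IHm] u uI uu lem;
  case: (classic (no_idempotent (annihilated_by I u))) => [?|nK]; try by exists u.
  case: nK => v; move: lem; rewrite leqn0 dimv_eq0 => /eqP->.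
  by rewrite memv0 => /eqP.
have [v [vI vu vv v0]] : exists v, [/\ v \in I, v * u = 0, v * v = v & v <> 0].
  apply: NNPP => nv; apply: nK => v; rewrite mem_annihilated_by => /andP[vI /eqP vu] vv.
  by apply: NNPP => v0; case: nv; exists v.
pose u' := u + v - u * v.
have u'I : u' \in I by rewrite memvB ?memvD // closedI.
have uu' : u * u' = u by rewrite /u' mulrBr mulrDr mulrA uu addrK.
have vu' : v * u' = v.
  by rewrite /u' mulrBr mulrDr mulrA vu vv mul0r add0r subr0.
have u'u : u' * u = u by rewrite /u' mulrBl mulrDl -mulrA uu vu mulr0 subr0 addr0.
have u'u' : u' * u' = u' by rewrite {1}/u' mulrBl mulrDl -mulrA uu' vu'.
apply: (IHm u') => //; rewrite -ltnS (leq_trans _ lem) //.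
have sub : (annihilated_by I u' <= annihilated_by I u)%VS.
  apply/subvP => x; rewrite !mem_annihilated_by => /andP[-> /eqP xu'].
  by rewrite -u'u mulrA xu' mul0r eqxx.
rewrite (ltn_leqif (dimv_leqif_sup sub)).
apply/negP => /subvP/(_ v); rewrite !mem_annihilated_by vI vu eqxx vu' => /(_ isT)/eqP.
exact: v0.
Qed.

(** Forward, the decomposition of 1 along A z and a complement provides a right
    identity of z inside A z.  Conversely, take w as in [max_idempotent]: if z in
    the left ideal is killed by w, then y z is an idempotent killed by w, hence zero,
    and so is z = z y z. *)
Lemma semisimple_regular : semisimple A <-> regular_in fullv.
Proof.
split=> [ssA z _|regA I lI].
  have lz : left_ideal (fullv * <[z]>)%VS by rewrite /left_ideal prodvA prodvSl ?subvf.
  have [J [lJ sumJ capJ]] := ssA _ lz.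
  have : 1 \in (fullv * <[z]> + J)%VS by rewrite sumJ memvf.
  case/memv_addP => u uz [v vJ uv1].
  have zzu : z = z * u.
    apply/eqP; rewrite -subr_eq0 -memv0 -capJ memv_cap.
    apply/andP; split.
      rewrite memvB //; first by rewrite -{1}[z]mul1r memv_mul ?memvf ?memv_line.
      by apply: (subvP lz); rewrite memv_mul ?memvf.
    rewrite -{1}[z]mulr1 uv1 mulrDr addrC addKr.
    by apply: (subvP lJ); rewrite memv_mul ?memvf.
  move: uz; rewrite -limg_amulr => /memv_imgP[y _ uy].
  by exists y; rewrite ?memvf // [RHS]zzu uy lfunE /= mulrA.
have closedI : {in I &, forall x y, x * y \in I}.
  by move=> x y _ yI; apply: (subvP lI); rewrite memv_mul ?memvf.
have [w [wI ww nK]] := max_idempotent closedI.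
have K0 x : x \in I -> x * w = x.
  move=> xI; apply/eqP; rewrite eq_sym -subr_eq0.
  set z := x - x * w.
  have zI : z \in I by rewrite memvB // closedI.
  have zw : z * w = 0 by rewrite mulrBl -mulrA ww subrr.
  have [y _ zyz] := regA z (memvf _).
  rewrite -zyz -mulrA [y * z]nK ?mulr0 //.
    by rewrite mem_annihilated_by -mulrA zw mulr0 eqxx andbT (subvP lI) // memv_mul ?memvf.
  by rewrite -mulrA [z * _]mulrA zyz.
exists (lker (amulr w)); split.
- apply/prodvP => a x _; rewrite !memv_ker !lfunE /= -mulrA => /eqP->.
  by rewrite mulr0.
- apply/eqP; rewrite eqEsubv subvf /=; apply/subvP => x _.
  rewrite -[x](subrK (x * w)) addrC memv_add //.
    by apply: (subvP lI); rewrite memv_mul ?memvf.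
  by rewrite memv_ker lfunE /= mulrBl -mulrA ww subrr.
- apply/eqP; rewrite -subv0; apply/subvP => x.
  by rewrite memv_cap memv_ker lfunE /= memv0 => /andP[/K0->].
Qed.

End RingTheory.

Lemma regular_subvs (F : fieldType) (A : falgType F) (B : {aspace A}) :
  semisimple (subvs_of B : falgType F) <-> regular_in B.
Proof.
rewrite semisimple_regular; split=> [H z zB|H z _].
  have [y _ /(congr1 val) /= E] := H (Subvs zB) (memvf _).
  by exists (val y); first exact: subvsP.
have [y yB E] := H (val z) (subvsP z).
by exists (Subvs yB); rewrite ?memvf //; apply: val_inj.
Qed.

(** * Regularity from a corner, a quotient and a trace *)

Section RegularExtension.
Variables (F : fieldType) (A : falgType F) (B J : {vspace A}) (e : A).
Variables (tau : A -> F) (gT : finGroupType) (G : {group gT}) (rho : gT -> A).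
Implicit Types (K : {vspace A}) (k x y a b : A).

Hypotheses (B1 : 1 \in B) (BM : {in B &, forall x y, x * y \in B}).
Hypotheses (JB : (J <= B)%VS) (BJ : {in B & J, forall x j, x * j \in J}).
Hypotheses (JrB : {in J & B, forall j x, j * x \in J}).
Hypotheses (eJ : e \in J) (J_sub : (J <= B * <[e]> * B)%VS).
Hypothesis corner : {in B, forall x,
  exists2 y, y \in B & (e * x * e) * y * (e * x * e) = e * x * e}.
Hypotheses (ee : e * e = e) (tau0 : tau 0 = 0).
Hypothesis tauC : forall x y, tau (x * y) = tau (y * x).
Hypothesis tau_nondeg :
  {in J, forall j, {in B, forall x, tau (j * x) = 0} -> j = 0}.
Hypotheses (rho1 : rho 1%g = 1) (rhoB : {in G, forall g, rho g \in B}).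
Hypothesis rhoM : {in G &, forall g h, rho (g * h)%g = rho g * rho h}.
Hypothesis card_G : #|G|%:R != 0 :> F.
Hypothesis B_span : {in B, forall x,
  exists c : gT -> F, x - \sum_(g in G) c g *: rho g \in J}.

Let eB : e \in B. Proof. exact: (subvP JB). Qed.

Lemma BeB_sub K : {in B &, forall a b, a * e * b \in K} -> (J <= K)%VS.
Proof.
move=> HK; apply: subv_trans J_sub _; apply/prodvP => x b.
by rewrite -limg_amulr => /memv_imgP[a aB ->] bB; rewrite lfunE HK.
Qed.

Section LeftIdeal.
Variable K : {vspace A}.
Hypotheses (KB : (K <= B)%VS) (BK : {in B & K, forall x k, x * k \in K}).
Hypothesis nK : no_idempotent K.

(** An element m = e a k b e of the corner with generalised inverse y' produces the
    idempotent b e y' e a k of K. *)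
Lemma corner_eq0 a k b : a \in B -> k \in K -> b \in B -> e * a * k * b * e = 0.
Proof.
move=> aB kK bB; have kB := subvP KB _ kK.
have [y yB] : exists2 y, y \in B &
    (e * (a * k * b) * e) * y * (e * (a * k * b) * e) = e * (a * k * b) * e.
  by apply: corner; rewrite !BM.
set m0 := e * (a * k * b) * e.
have mE : m0 = e * a * k * b * e by rewrite /m0 !mulrA.
rewrite -mE; have mB : m0 \in B by rewrite !BM.
move: m0 mE mB => m mE mB mym.
(* y m y is a generalised inverse of m for which m is one as well *)
have [y' [y'B my'm y'my']] : exists y', [/\ y' \in B, m * y' * m = m & y' * m * y' = y'].
  exists (y * m * y); split; first by rewrite !BM.
    by rewrite !mulrA !mym.
  by rewrite -!mulrA (mulrA m) (mulrA (m * y)) mym (mulrA m) (mulrA (m * y)) mym.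
have v0 : b * e * y' * e * a * k = 0.
  apply: nK; first by rewrite BK ?BM.
  rewrite -{3}y'my' mE !mulrA; do ?congr (_ * _).
rewrite -my'm {1 2}mE.
have -> : e * a * k * b * e * y' * (e * a * k * b * e) =
   e * a * k * (b * e * y' * e * a * k) * b * e by rewrite !mulrA.
by rewrite v0 mulr0 !mul0r.
Qed.

(** By cyclicity the trace of (k b e) x equals that of e x k b e, which vanishes, and
    k b e lies in J, where the form is nondegenerate. *)
Lemma left_ideal_mul_e k b : k \in K -> b \in B -> k * b * e = 0.
Proof.
move=> kK bB; have kB := subvP KB _ kK.
apply: tau_nondeg => [|x xB]; first by rewrite BJ ?BM.
have -> : k * b * e * x = k * b * e * (e * x) by rewrite -!mulrA (mulrA e) ee.
by rewrite tauC !mulrA corner_eq0.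
Qed.

Lemma e_mul_left_ideal b k : b \in B -> k \in K -> e * b * k = 0.
Proof.
move=> bB kK; have kB := subvP KB _ kK.
apply: tau_nondeg => [|x xB]; first by rewrite !JrB ?BM.
have -> : e * b * k * x = e * (e * b * k * x) by rewrite !mulrA ee.
by rewrite tauC corner_eq0.
Qed.

Lemma left_ideal_mul_J : {in K & J, forall k j, k * j = 0}.
Proof.
move=> k j kK jJ; suff /subvP/(_ j jJ) : (J <= lker (amull k))%VS.
  by rewrite memv_ker lfunE => /eqP.
apply: BeB_sub => a b aB bB.
by rewrite memv_ker lfunE /= !mulrA left_ideal_mul_e ?mul0r.
Qed.

End LeftIdeal.

(** Let u be a maximal idempotent of J.  The elements of J that u annihilates form a
    left ideal without idempotents, so e kills e b - e b u, which means that
    e b = e b u; and the products a e b span J. *)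
Lemma right_identity : exists2 u, u \in J & {in J, forall j, j * u = j}.
Proof.
have [|u [uJ uu nK]] := @max_idempotent _ _ J.
  by move=> x y xJ yJ; rewrite BJ // (subvP JB).
exists u => //.
have KB : (annihilated_by J u <= B)%VS.
  by apply/subvP => x; rewrite mem_annihilated_by => /andP[/(subvP JB)].
have BK : {in B & annihilated_by J u, forall x k, x * k \in annihilated_by J u}.
  by move=> x k xB; rewrite !mem_annihilated_by => /andP[kJ /eqP ku];
    rewrite BJ //= -mulrA ku mulr0.
suff /subvP fixJ : (J <= lker (amulr u - \1%VF))%VS.
  by move=> j /fixJ; rewrite memv_ker add_lfunE opp_lfunE id_lfunE lfunE /= subr_eq0 => /eqP.
apply: BeB_sub => a b aB bB; rewrite memv_ker add_lfunE opp_lfunE id_lfunE lfunE /= subr_eq0.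
have ebJ : e * b \in J by rewrite JrB.
have kK : e * b - e * b * u \in annihilated_by J u.
  rewrite mem_annihilated_by memvB ?(JrB ebJ) ?(subvP JB _ uJ) //=.
  by rewrite mulrBl -(mulrA (e * b)) uu subrr.
have := e_mul_left_ideal KB BK nK B1 kK.
rewrite mulr1 mulrBr !mulrA ee => /eqP; rewrite subr_eq0 => /eqP E.
by rewrite -!mulrA (mulrA e) -E.
Qed.

(** Averaging a projection onto K + J over G makes it linear for G, hence for B
    modulo J, so it is right multiplication by its value k + j at 1 modulo J.
    Thus x = x k modulo J for x in K; since K J = 0 this forces k^2 = k^3, so k^2 is
    an idempotent of K, hence zero, and K is contained in J = J u, which it
    annihilates. *)
Lemma no_idempotent_eq0 K : (K <= B)%VS ->
  {in B & K, forall x k, x * k \in K} -> no_idempotent K -> {in K, forall k, k = 0}.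
Proof.
move=> KB BK nK; have KJ0 := left_ideal_mul_J KB BK nK.
have [u uJ Ju] := right_identity.
pose P := projv (K + J)%VS.
pose Q x := #|G|%:R^-1 *: \sum_(g in G) rho g * P (rho g^-1%g * x).
have KJB x : x \in (K + J)%VS -> x \in B.
  by apply/subvP; rewrite subv_add KB.
have BKJ : {in B & (K + J)%VS, forall x k, x * k \in (K + J)%VS}.
  move=> x _ xB /memv_addP[k kK [j jJ ->]].
  by rewrite mulrDr memv_add ?BK ?BJ.
have QKJ x : Q x \in (K + J)%VS.
  by rewrite memvZ // memv_suml // => g gG; rewrite BKJ ?rhoB ?memv_proj.
have Qid x : x \in (K + J)%VS -> Q x = x.
  move=> xKJ; rewrite /Q (eq_bigr (fun=> x)).
    by rewrite sumr_const -scaler_nat scalerA mulVf ?scale1r.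
  move=> g gG; rewrite projv_id ?BKJ ?rhoB ?groupV // mulrA -rhoM ?groupV //.
  by rewrite mulgV rho1 mul1r.
have QM h x : h \in G -> Q (rho h * x) = rho h * Q x.
  move=> hG; rewrite /Q -scalerAr mulr_sumr; congr (_ *: _).
  rewrite (reindex_inj (mulgI h)) /=; apply: eq_big => [g|g gG].
    by rewrite groupMl.
  rewrite groupMl // in gG.
  have -> : rho (h * g)^-1%g * (rho h * x) = rho g^-1%g * x.
    by rewrite mulrA -rhoM ?groupV ?groupM // invMg mulgKV.
  by rewrite rhoM // mulrA.
have QD x y : Q (x + y) = Q x + Q y.
  rewrite /Q -scalerDr -big_split; congr (_ *: _); apply: eq_bigr => g _ /=.
  by rewrite mulrDr linearD mulrDr.
have QZ c x : Q (c *: x) = c *: Q x.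
  rewrite /Q [RHS]scalerA mulrC -scalerA; congr (_ *: _); rewrite scaler_sumr.
  by apply: eq_bigr => g _ /=; rewrite -scalerAr linearZ -scalerAr.
have Q0 : Q 0 = 0 by rewrite -[0](scale0r 0) QZ !scale0r.
have [k kK [j jJ Q1]] := memv_addP (QKJ 1).
have xk x : x \in K -> x - x * k \in J.
  move=> xK; have xB := subvP KB _ xK.
  have xKJ : x \in (K + J)%VS by rewrite -[x]addr0 memv_add ?mem0v.
  have [c] := B_span xB; set s := \sum_(g in G) _; set j1 := x - s => j1J.
  have Qs : Q s = s * Q 1.
    rewrite /s mulr_suml (big_morph Q QD Q0); apply: eq_bigr => g gG.
    by rewrite QZ -[X in Q X]mulr1 QM // scalerAl.
  have xE : x = s * Q 1 + j1.
    rewrite -Qs -[X in _ + X]Qid ?(subvP (addvSr _ _)) // -QD.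
    by rewrite /j1 addrC subrK Qid.
  have sE : s = x - j1 by rewrite /j1 opprB addrC subrK.
  have -> : x - x * k = j1 + x * j - j1 * Q 1.
    rewrite {1}xE sE Q1 mulrBl mulrDr.
    move: (x * k) (x * j) (j1 * _) => p q t.
    by rewrite -[p + q - t]addrA [p + _]addrC [_ + p + j1]addrAC addrK addrC addrA.
  by apply: memvB; [apply: memvD => //; exact: BJ | apply: JrB => //; apply: KJB].
have kB := subvP KB _ kK.
have k3 : k * k = k * k * k.
  apply/eqP; rewrite -subr_eq0 -mulrA -mulrBr; apply/eqP.
  by apply: KJ0 => //; apply: xk.
have kk0 : k * k = 0.
  by apply: nK; [rewrite BK | rewrite mulrA -k3 -k3].
have kJ : k \in J by have := xk _ kK; rewrite kk0 subr0.
move=> x xK; have xJ : x \in J.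
  by rewrite -[x](subrK (x * k)) memvD ?xk ?BJ // (subvP KB).
by rewrite -(Ju _ xJ) KJ0.
Qed.

(** The elements of B z annihilated by a maximal idempotent w of B z form a left ideal
    without idempotents, hence zero.  So z = z w, and w is of the form y z. *)
Theorem regular_extension : regular_in B.
Proof.
move=> z zB; pose I := (B * <[z]>)%VS.
have IB : (I <= B)%VS.
  by apply/prodvP => x y xB /vlineP[c ->]; rewrite -scalerAr memvZ ?BM.
have BI : {in B & I, forall x y, x * y \in I}.
  move=> x y xB; rewrite /I -limg_amulr => /memv_imgP[b bB ->].
  by apply/memv_imgP; exists (x * b); rewrite ?BM // !lfunE /= mulrA.
have [|w [wI ww nK]] := @max_idempotent _ _ I.
  by move=> x y /(subvP IB) xB yI; apply: BI.
have K0 : {in annihilated_by I w, forall k, k = 0}.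
  apply: no_idempotent_eq0 nK.
    by apply/subvP => x; rewrite mem_annihilated_by => /andP[/(subvP IB)].
  by move=> x k xB; rewrite !mem_annihilated_by => /andP[kI /eqP kw];
    rewrite BI //= -mulrA kw mulr0.
have zI : z \in I by rewrite -[z]mul1r memv_mul ?memv_line.
have zw : z = z * w.
  apply/eqP; rewrite -subr_eq0; apply/eqP/K0; rewrite mem_annihilated_by.
  by rewrite memvB ?BI //= mulrBl -mulrA ww subrr.
move: wI; rewrite /I -limg_amulr => /memv_imgP[y yB wE].
by exists y; rewrite // [RHS]zw wE lfunE /= mulrA.
Qed.

End RegularExtension.

(** * Products of diagrams by counting colourings *)

Section CountColourings.
Variables (T W K : finType) (e : rel T) (o : W -> T) (k0 : K).
Hypothesis sym_e : symmetric e.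
Let csym : connect_sym e. Proof. exact: sym_connect_sym. Qed.

Lemma constant_connect (S : Type) (g : T -> S) x y :
  (forall x y, e x y -> g x = g y) -> connect e x y -> g x = g y.
Proof.
by move=> ge xy; apply: (@connect_step _ _ (fun z => g x = g z) _ _ xy) => // u v -> /ge.
Qed.

(** A colouring that is constant on components and prescribed on the image of o
    amounts to a free choice on each component missing that image. *)
Lemma card_extension (f : W -> K) :
  (forall w w', connect e (o w) (o w') -> f w = f w') ->
  #|[set g : {ffun T -> K} | [forall x, forall y, e x y ==> (g x == g y)] &&
      [forall w, g (o w) == f w]]| =
  (#|K| ^ n_comp e [pred v | [forall w, ~~ connect e v (o w)]])%N.
Proof.
move=> fP; set free := [pred v | _].
pose R := [predI roots e & free].
rewrite /n_comp_mem -(card_pffun_on k0 R predT).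
(* the value at the root of a free component is the free choice; k0 only pads *)
pose ext (h : {ffun T -> K}) : {ffun T -> K} :=
  [ffun x => if [pick w | connect e x (o w)] is Some w then f w else h (fingraph.root e x)].
have freeP x : [pick w | connect e x (o w)] = None <-> free x.
  split; first by case: pickP => // H _; apply/forallP => w; rewrite H.
  by move=> /forallP H; case: pickP => // w; rewrite (negPf (H w)).
have free_root x : free (fingraph.root e x) = free x.
  by apply: eq_forallb => w; rewrite -(same_connect csym (connect_root e x)).
rewrite -(@card_in_imset _ _ ext (pffun_on k0 R predT)); last first.
  move=> h1 h2 /pffun_onP[/supportP s1 _] /pffun_onP[/supportP s2 _] /ffunP E.
  apply/ffunP => x; case: (boolP (x \in R)) => [|xR]; last by rewrite s1 ?s2.
  case/andP=> /eqP rx /freeP fx; have := E x; rewrite !ffunE fx.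
  by rewrite rx.
apply: eq_card => g; rewrite inE; apply/andP/imsetP => [[/forallP ge /forallP go]|].
  have {}ge x y : e x y -> g x = g y by move=> xy; have /forallP/(_ y) := ge x; rewrite xy => /eqP.
  exists [ffun x => if x \in R then g x else k0].
    apply/pffun_onP; split=> //; apply/supportP => x xR.
    by rewrite ffunE (negPf xR).
  apply/ffunP => x; rewrite ffunE; case: pickP => [w xw|H].
    by rewrite (constant_connect ge xw) (eqP (go w)).
  have fx : free x by apply/forallP => w; rewrite H.
  rewrite ffunE; have -> : fingraph.root e x \in R.
    by apply/andP; split; [apply: roots_root | exact: (etrans (free_root x) fx)].
  by apply: constant_connect ge _; apply: connect_root.
case=> h /pffun_onP[/supportP hs _] ->; split.
  apply/forallP => x; apply/forallP => y; apply/implyP => /connect1 xy.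
  rewrite !ffunE; have -> : [pick w | connect e x (o w)] = [pick w | connect e y (o w)].
    by apply: eq_pick => w; apply: same_connect.
  case: pickP => // _; by rewrite (fingraph.rootP csym xy).
apply/forallP => w; rewrite ffunE; case: pickP => [w' ww'|/(_ w)].
  by apply/eqP/esym/fP.
by rewrite connect0.
Qed.

End CountColourings.

Section Colourings.
Variable n : nat.
Implicit Types (a b c d : diagram n) (x y : vertex n).

Definition glue (K : Type) (u v : 'I_n -> K) (x : vertex n) : K :=
  match x with inl i => u i | inr i => v i end.

Definition compat (K : eqType) a (f : vertex n -> K) : bool :=
  [forall x, forall y, same_block a x y ==> (f x == f y)].

Lemma compatP (K : eqType) a (f : vertex n -> K) :
  reflect (forall x y, same_block a x y -> f x = f y) (compat a f).
Proof.
apply: (iffP forallP) => [H x y xy|H x].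
  by have /forallP/(_ y)/implyP/(_ xy)/eqP := H x.
by apply/forallP => y; apply/implyP => /H/eqP.
Qed.

Lemma eq_compat (K : eqType) a (f g : vertex n -> K) : f =1 g -> compat a f = compat a g.
Proof. by move=> E; apply: eq_forallb => x; apply: eq_forallb => y; rewrite !E. Qed.

Lemma same_block_compat a x y :
  (forall u v : {ffun 'I_n -> bool}, compat a (glue u v) -> glue u v x = glue u v y) ->
  same_block a x y.
Proof.
move=> H.
pose u := [ffun i => same_block a x (inl i)]; pose v := [ffun i => same_block a x (inr i)].
have E : glue u v =1 same_block a x by case=> i; rewrite /= ffunE.
have := H u v; rewrite !E same_block_refl => <- //.
apply/compatP => z t zt; rewrite !E.
by apply/idP/idP => /same_block_trans; apply=> //; rewrite same_block_sym.
Qed.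

(** Every diagram is the kernel of some labelling; this is the form in which all
    diagrams below are built. *)
Definition kdiag (T : eqType) (f : vertex n -> T) : diagram n :=
  Diagram (preim_partitionP f [set: vertex n]).

Lemma same_block_kdiag (T : eqType) (f : vertex n -> T) x y :
  same_block (kdiag f) x y = (f x == f y).
Proof.
rewrite /same_block /= /preim_partition pblock_equivalence_partition ?inE //.
by move=> u v w _ _ _; split=> // /eqP->.
Qed.

Definition middle (K : finType) a b (u v : 'I_n -> K) : nat :=
  #|[set m : {ffun 'I_n -> K} | compat a (glue u m) && compat b (glue m v)]|.

(** On the space of colourings of a row by K, a diagram acts by the 0/1 matrix
    of its compatible colourings.  The product of two such matrices counts the
    colourings of the middle row, where each loop can be coloured freely. *)
Lemma card_middle (K : finType) (k0 : K) a b (u v : 'I_n -> K) :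
  middle a b u v = (compat (dcomp a b) (glue u v) * #|K| ^ dloops a b)%N.
Proof.
pose st m (x : stack_vertex n) : K :=
  match x with inl (inl i) => u i | inl (inr i) => m i | inr i => v i end.
have st_up m z : st m (upper z) = glue u m z by case: z.
have st_lo m z : st m (lower z) = glue m v z by case: z.
have st_out m z : st m (outer z) = glue u v z by case: z.
have stP m : (compat a (glue u m) && compat b (glue m v)) =
    [forall x, forall y, stack a b x y ==> (st m x == st m y)].
  apply/andP/forallP => [[/compatP Ca /compatP Cb] x|H].
    apply/forallP => y; apply/implyP; rewrite stackE => /orP[]/linkP[z [t [<- <- zt]]].
      by rewrite !st_up (Ca _ _ zt).
    by rewrite !st_lo (Cb _ _ zt).
  split; apply/compatP => x y xy.
    rewrite -!st_up; have /forallP/(_ (upper y))/implyP/(_ _)/eqP := H (upper x); apply.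
    by rewrite stackE; apply/orP; left; apply/linkP; exists x, y.
  rewrite -!st_lo; have /forallP/(_ (lower y))/implyP/(_ _)/eqP := H (lower x); apply.
  by rewrite stackE; apply/orP; right; apply/linkP; exists x, y.
case: (boolP (compat _ _)) => [/compatP Cab|nC]; last first.
  rewrite mul0n; apply: eq_card0 => m; rewrite inE stP; apply/negP => /forallP H.
  case/negP: nC; apply/compatP => x y; rewrite same_block_dcomp => xy.
  rewrite -!(st_out m); apply: constant_connect xy => z t zt.
  by have /forallP/(_ t)/implyP/(_ zt)/eqP := H z.
rewrite mul1n -(@card_extension _ _ _ _ (@outer n) k0 (@stack_sym n a b) (glue u v)); last first.
  by move=> w w' ww'; apply: Cab; rewrite same_block_dcomp.
pose big (m : {ffun 'I_n -> K}) : {ffun stack_vertex n -> K} := finfun (st m).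
rewrite /middle -(@card_imset _ _ big); last first.
  by move=> m m' /ffunP E; apply/ffunP => i; have := E (inl (inr i)); rewrite !ffunE.
apply: eq_card => g; rewrite inE; apply/imsetP/andP => [[m]|[/forallP gst /forallP go]].
  rewrite inE stP => H ->; split.
    by under eq_forallb => x do under eq_forallb => y do rewrite !ffunE.
  by apply/forallP => w; rewrite ffunE st_out.
have gE : g =1 st [ffun i => g (inl (inr i))].
  case=> [[i|i]|i] /=; last 1 first.
  - exact/eqP/(go (inr i)).
  - exact/eqP/(go (inl i)).
  by rewrite ffunE.
exists [ffun i => g (inl (inr i))]; last by apply/ffunP => x; rewrite ffunE.
rewrite inE stP; apply/forallP => x; apply/forallP => y; rewrite -!gE.
exact: (forallP (gst x)).
Qed.

End Colourings.

Section Products.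
Variables (F : fieldType) (delta : F) (n : nat).
Implicit Types (a b c d : diagram n) (x y : vertex n).
Local Notation bools := {ffun 'I_n -> bool}.
Local Notation V := (diagram_vect delta).

Lemma compat_inj a b :
  (forall u v : bools, compat a (glue u v) = compat b (glue u v)) -> a = b.
Proof.
move=> E; apply: same_block_inj => x y; apply/idP/idP => xy;
  apply: same_block_compat => u v; [rewrite -E|rewrite E] => /compatP C; exact: C.
Qed.

Lemma compat_const (K : eqType) a (k : K) : compat a (glue (fun=> k) (fun=> k)).
Proof. by apply/compatP => -[i|i] [j|j]. Qed.

Lemma middle_bool a b (u v : bools) :
  middle a b u v = (compat (dcomp a b) (glue u v) * 2 ^ dloops a b)%N.
Proof. by rewrite (card_middle true) card_bool. Qed.

(** Two colours determine a diagram, and the constant colouring reads off the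
    number of loops, so one count identifies the whole product. *)
Lemma middle_unique a b c l :
  (forall u v : bools, middle a b u v = (compat c (glue u v) * 2 ^ l)%N) ->
  dcomp a b = c /\ dloops a b = l.
Proof.
move=> H; have cst d : compat d (glue ([ffun=> true] : bools) ([ffun=> true] : bools)).
  by rewrite (eq_compat _ (g := glue (fun=> true) (fun=> true))) ?compat_const //;
    case=> i /=; rewrite ffunE.
have El : dloops a b = l.
  by have /eqP := H [ffun=> true] [ffun=> true]; rewrite middle_bool !cst !mul1n eqn_exp2l // => /eqP.
split=> //; apply: compat_inj => u v.
have /eqP := H u v; rewrite middle_bool El eqn_pmul2r ?expn_gt0 //.
by case: (compat _ _); case: (compat _ _).
Qed.

Lemma mul_vect_middle a b c l :
  (forall u v : bools, middle a b u v = (compat c (glue u v) * 2 ^ l)%N) ->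
  V a * V b = delta ^+ l *: V c.
Proof. by move=> /middle_unique[E1 E2]; rewrite mul_diagram_vect E1 E2. Qed.

Lemma mul_vect_scale a b a' b' s :
  (forall u v : bools, middle a b u v = (2 ^ s * middle a' b' u v)%N) ->
  V a * V b = delta ^+ s *: (V a' * V b').
Proof.
move=> H; rewrite [in RHS]mul_diagram_vect scalerA -exprD.
apply: mul_vect_middle => u v.
by rewrite H middle_bool mulnCA expnD.
Qed.

(** If the outer colouring determines the middle one there is no loop. *)
Lemma mul_vect_fun a b c (m : bools -> bools -> bools) :
  (forall (u v : bools), compat c (glue u v) ->
     compat a (glue u (m u v)) && compat b (glue (m u v) v)) ->
  (forall u v w : bools, compat a (glue u w) -> compat b (glue w v) ->
     compat c (glue u v) /\ w = m u v) ->
  V a * V b = V c.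
Proof.
move=> H1 H2; rewrite -[RHS]scale1r -(expr0 delta); apply: mul_vect_middle => u v.
case: (boolP (compat c _)) => [C|nC]; last first.
  apply: eq_card0 => w; rewrite inE; apply/negP => /andP[Ca Cb].
  by case/negP: nC; have [] := H2 _ _ _ Ca Cb.
rewrite /middle (_ : [set _ | _] = [set m u v]) ?cards1 //.
apply/setP => w; rewrite !inE; apply/andP/eqP => [[Ca Cb]|->].
  by have [_ ->] := H2 _ _ _ Ca Cb.
exact/andP/H1.
Qed.

End Products.

(** * Refinement of diagrams and powers of the parameter *)

Section Pull.
Variables (m n : nat) (f : vertex m -> vertex n).

(** The blocks of a serve as labels. *)
Definition pull (a : diagram n) : diagram m := kdiag (fun x => pblock (blocks a) (f x)).

Lemma same_block_pull a x y : same_block (pull a) x y = same_block a (f x) (f y).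
Proof.
rewrite same_block_kdiag /same_block; case: a => P /= /and3P[/eqP cP tP _].
by rewrite eq_pblock // cP inE.
Qed.

End Pull.

Section Refinement.
Variable n : nat.
Implicit Types (a b c s : diagram n) (x y : vertex n).

Definition refines a s := [forall x, forall y, same_block a x y ==> same_block s x y].

Lemma refinesP a s :
  reflect (forall x y, same_block a x y -> same_block s x y) (refines a s).
Proof.
apply: (iffP forallP) => [H x y xy|H x].
  by have /forallP/(_ y)/implyP/(_ xy) := H x.
by apply/forallP => y; apply/implyP => /H.
Qed.

Lemma refines_refl a : refines a a. Proof. exact/refinesP. Qed.

Lemma compat_kdiag (K : eqType) a (g : vertex n -> K) : compat a g = refines a (kdiag g).
Proof.
by apply: eq_forallb => x; apply: eq_forallb => y; rewrite same_block_kdiag.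
Qed.

(** A rank function for inductions along refinement. *)
Definition coarseness a := #|[set p : vertex n * vertex n | same_block a p.1 p.2]|.

Lemma coarseness_lt a b : refines a b -> a != b -> (coarseness a < coarseness b)%N.
Proof.
move=> /refinesP ab nab; apply: proper_card; rewrite properE.
have -> /= : [set p | same_block a p.1 p.2] \subset [set p | same_block b p.1 p.2].
  by apply/subsetP => p; rewrite !inE => /ab.
apply: contra nab => /subsetP ba; apply/eqP/same_block_inj => x y.
by apply/idP/idP => [/ab|xy]; first by []; have := ba (x, y); rewrite !inE; apply.
Qed.

Definition nblocks a := #|blocks a|.

(** A colouring with kernel s is an injective colouring of the blocks of s. *)
Lemma card_kernel (K : finType) s :
  #|[set g : {ffun vertex n -> K} | kdiag g == s]| = (#|K| ^_ nblocks s)%N.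
Proof.
pose T := {B : {set vertex n} | B \in blocks s}.
have /and3P[/eqP cP tP n0] : partition (blocks s) [set: vertex n] by case: (s).
have inP x : pblock (blocks s) x \in blocks s by rewrite pblock_mem // cP inE.
pose blk x : T := exist (fun B => is_true (B \in blocks s)) _ (inP x).
have blkE x y : (blk x == blk y) = same_block s x y.
  by rewrite -val_eqE /= eq_pblock // cP inE.
have rep (B : T) : {x | blk x == B}.
  apply: sigW; case: B => B BP; have /set0Pn[x xB] : B != set0 by apply: contraNneq n0 => <-.
  by exists x; apply/eqP/val_inj; apply: def_pblock.
pose rp B := sval (rep B); have rpK B : blk (rp B) = B by apply/eqP; apply: (svalP (rep B)).
have -> : nblocks s = #|{: T}| by rewrite card_sig.
rewrite -card_inj_ffuns.
pose h (k : {ffun T -> K}) : {ffun vertex n -> K} := [ffun x => k (blk x)].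
rewrite -(@card_imset _ _ h); last first.
  by move=> k1 k2 /ffunP E; apply/ffunP => B; have := E (rp B); rewrite !ffunE rpK.
apply: eq_card => g; rewrite inE; apply/eqP/imsetP => [gs|[k]].
  have gE x y : (g x == g y) = (blk x == blk y) by rewrite blkE -gs same_block_kdiag.
  exists [ffun B => g (rp B)].
    rewrite inE; apply/injectiveP => B C; rewrite !ffunE.
    by move/eqP; rewrite gE !rpK => /eqP.
  apply/ffunP => x; rewrite !ffunE.
  by apply/eqP; rewrite gE rpK.
rewrite inE => /injectiveP inj_k ->; apply: same_block_inj => x y.
by rewrite same_block_kdiag !ffunE (inj_eq inj_k) blkE.
Qed.

Lemma nblocks_gt0 s (x : vertex n) : (0 < nblocks s)%N.
Proof.
have /and3P[/eqP cP _ _] : partition (blocks s) [set: vertex n] by case: (s).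
by rewrite card_gt0; apply/set0Pn; exists (pblock (blocks s) x); rewrite pblock_mem // cP inE.
Qed.

Definition join a b := n_comp (relU (same_block a) (same_block b)) predT.

Lemma card_join (K : finType) (k0 : K) a b :
  #|[set g : {ffun vertex n -> K} | compat a g && compat b g]| = (#|K| ^ join a b)%N.
Proof.
have sy : symmetric (relU (same_block a) (same_block b)).
  by move=> x y /=; rewrite !(same_block_sym _ y).
have := @card_extension _ _ K _ (@of_void (vertex n)) k0 sy (@of_void K).
rewrite (eq_n_comp_r (a' := predT)); last first.
  move=> x; rewrite !inE; apply/forallP; case.
move=> <-; last by case.
apply: eq_card => g; rewrite !inE.
have -> : [forall w, g (of_void (vertex n) w) == of_void K w] by apply/forallP; case.
rewrite andbT.
apply/andP/forallP => [[/compatP Ca /compatP Cb] x|H].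
  by apply/forallP => y; apply/implyP => /orP[/Ca->|/Cb->].
by split; apply/compatP => x y xy; apply/eqP; have /forallP/(_ y)/implyP := H x; apply;
  rewrite /= xy ?orbT.
Qed.

Lemma ffact_join N a b :
  (N.+1 ^ join a b)%N = (\sum_(s | refines a s && refines b s) N.+1 ^_ nblocks s)%N.
Proof.
have := @card_join 'I_N.+1 ord0 a b; rewrite card_ord => <-.
rewrite -sum1dep_card (partition_big (fun g : {ffun _ -> _} => kdiag g)
  (fun s => refines a s && refines b s)); last by move=> g; rewrite !compat_kdiag.
apply: eq_bigr => s abs; have := card_kernel 'I_N.+1 s; rewrite card_ord => <-; rewrite -sum1dep_card.
apply: eq_bigl => g; rewrite !compat_kdiag; case: eqP => [->|_]; last exact: andbF.
by rewrite abs.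
Qed.

Lemma join_gt0 a b (x : vertex n) : (0 < join a b)%N.
Proof.
have := @card_join bool true a b; rewrite card_bool.
case: (join a b) => // /eqP; rewrite expn0 => /cards1P[g0 E].
have C (k : bool) : [ffun=> k] = g0.
  apply/set1P; rewrite -E inE; apply/andP.
  by split; apply/compatP => y z _; rewrite !ffunE.
by have /ffunP/(_ x) := etrans (C true) (esym (C false)); rewrite !ffunE.
Qed.

End Refinement.

Section FallingFactorial.

(** The falling factorial of x without its first factor x. *)
Definition falling (R : nzRingType) (x : R) k : R := \prod_(1 <= i < k) (x - i%:R).

Lemma ffact_falling (R : comNzRingType) (N k : nat) :
  (0 < k)%N -> ((N ^_ k)%:R = N%:R * falling (N%:R : R) k).
Proof.
case: k => // k _; elim: k => [|k IHk]; first by rewrite ffactn1 /falling big_geq ?mulr1.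
rewrite ffactnSr natrM IHk /falling [in RHS]big_nat_recr //= mulrA.
case: (leqP k.+1 N) => lekN; first by rewrite natrB.
suff -> : N%:R * \prod_(1 <= i < k.+1) (N%:R - i%:R) = 0 :> R by rewrite !mul0r.
by rewrite -/(falling _ _) -IHk ffact_small.
Qed.

Lemma poly_eq_nat (p q : {poly int}) :
  (forall N : nat, p.[N.+1%:R] = q.[N.+1%:R]) -> p = q.
Proof.
move=> H; apply/eqP; rewrite -subr_eq0; apply: contraT => pq.
have := max_poly_roots pq (rs := [seq i.+1%:R | i <- iota 0 (size (p - q))]).
rewrite size_map size_iota ltnn; apply.
  by apply/allP => _ /mapP[i _ ->]; rewrite rootE hornerE hornerN H subrr.
rewrite map_inj_uniq ?iota_uniq // => i j /eqP.
by rewrite Num.Theory.eqr_nat => /eqP[].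
Qed.

(** The polynomial identity behind [ffact_join], divided by X.  The division
    matters: the half-integral algebras allow delta = 0, where the factor delta
    would destroy nondegeneracy. *)
Lemma expr_join (F : fieldType) (delta : F) n (a b : diagram n.+1) :
  delta ^+ (join a b).-1 =
  \sum_(s | refines a s && refines b s) falling delta (nblocks s).
Proof.
have x0 : vertex n.+1 := inl ord0.
have := join_gt0 a b x0; case Ej: (join a b) => [//|j] _ /=.
have E : 'X^j = \sum_(s | refines a s && refines b s) falling ('X : {poly int}) (nblocks s).
  apply: (mulfI (negbT (polyX_eq0 _))); apply: poly_eq_nat => N.
  rewrite -exprS hornerXn -natrX -Ej ffact_join hornerM hornerX horner_sum mulr_sumr natr_sum.
  apply: eq_bigr => s _; rewrite ffact_falling ?nblocks_gt0 //; congr (_ * _).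
  rewrite horner_prod; apply: eq_bigr => i _.
  by rewrite hornerD hornerX hornerN -polyC_natr hornerC.
have := congr1 (fun p => (map_poly intr p).[delta]) E => /=.
rewrite map_polyXn hornerXn rmorph_sum /= horner_sum => ->.
apply: eq_bigr => s _; rewrite rmorph_prod horner_prod; apply: eq_bigr => i _.
by rewrite rmorphB /= map_polyX rmorph_nat hornerD hornerX hornerN -polyC_natr hornerC.
Qed.

End FallingFactorial.

(** * The trace form *)

Definition flipv n (x : vertex n) : vertex n :=
  match x with inl i => inr i | inr i => inl i end.

Lemma flipvK n : involutive (@flipv n). Proof. by case. Qed.

Definition flip n (a : diagram n) : diagram n := pull (@flipv n) a.

Lemma flipK n : involutive (@flip n).
Proof. by move=> a; apply: same_block_inj => x y; rewrite !same_block_pull !flipvK. Qed.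

Lemma compat_flip n (K : eqType) (d : diagram n) (u v : 'I_n -> K) :
  compat (flip d) (glue u v) = compat d (glue v u).
Proof.
have E z : glue u v z = glue v u (flipv z) by case: z.
apply/compatP/compatP => H x y xy; last by rewrite !E; apply: H; rewrite -same_block_pull.
by rewrite -[x]flipvK -[y]flipvK -!E; apply: H; rewrite same_block_pull !flipvK.
Qed.

Section Closure.
Variable n : nat.
Implicit Types (a b c : diagram n).
Local Notation bools := {ffun 'I_n -> bool}.

(** The components of the diagram on the circle, after joining each i with i'. *)
Definition cycles a := n_comp (link (@column n) a) predT.

Lemma card_cycles a : #|[set m : bools | compat a (glue m m)]| = (2 ^ cycles a)%N.
Proof.
have := @card_extension _ _ _ _ (@of_void 'I_n) true (@link_sym n _ (@column n) a)
  (@of_void bool).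
rewrite card_bool (eq_n_comp_r (a' := predT)); last first.
  by move=> x; rewrite !inE; apply/forallP; case.
move=> <-; last by case.
apply: eq_card => g; rewrite !inE.
have -> : [forall w, g (of_void 'I_n w) == of_void bool w] by apply/forallP; case.
rewrite andbT; have gE x : glue g g x = g (column x) by case: x.
apply/compatP/forallP => [Ca i|H x y xy].
  apply/forallP => j; apply/implyP => /linkP[x [y [<- <- xy]]].
  by rewrite -!gE (Ca _ _ xy).
rewrite !gE; have /forallP/(_ (column y))/implyP := H (column x); move=> E.
by apply/eqP/E/linkP; exists x, y.
Qed.

(** Closing the stack of a and b glues b upside down onto a. *)
Lemma card_stack_closure a b :
  (\sum_(u : bools) middle a b u u)%N = (2 ^ join a (flip b))%N.
Proof.
have := card_join true a (flip b); rewrite card_bool => <-.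
under eq_bigr => u _ do rewrite /middle -sum1dep_card.
rewrite pair_big_dep /= sum1dep_card.
pose h (p : bools * bools) : {ffun vertex n -> bool} := finfun (glue p.1 p.2).
rewrite -(@card_imset _ _ h); last first.
  move=> [u m] [u' m'] /ffunP E; congr (_, _); apply/ffunP => i.
    by have := E (inl i); rewrite !ffunE.
  by have := E (inr i); rewrite !ffunE.
have Ca p : compat a (h p) = compat a (glue p.1 p.2) by apply: eq_compat => x; rewrite ffunE.
have Cb p : compat (flip b) (h p) = compat b (glue p.2 p.1).
  by rewrite -compat_flip; apply: eq_compat => x; rewrite ffunE.
apply: eq_card => g; rewrite inE; apply/imsetP/idP => [[p]|].
  by rewrite inE => H ->; rewrite Ca Cb.
have -> : g = h ([ffun i => g (inl i)], [ffun i => g (inr i)]).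
  by apply/ffunP; case=> i; rewrite !ffunE /= ffunE.
by rewrite Ca Cb => H; exists ([ffun i => g (inl i)], [ffun i => g (inr i)]); rewrite ?inE.
Qed.

Lemma loops_cycles a b : (dloops a b + cycles (dcomp a b))%N = join a (flip b).
Proof.
apply: (@expnI 2 isT); rewrite -card_stack_closure expnD -card_cycles mulnC -sum1dep_card.
rewrite big_distrl big_mkcond; apply: eq_bigr => u _.
by rewrite middle_bool; case: (compat _ _).
Qed.

(** Exchanging the two rows of a closed stack is the cyclicity of the trace. *)
Lemma join_flipC a b : join a (flip b) = join b (flip a).
Proof.
have mE c d (u v : bools) : middle c d u v =
    (\sum_(m : bools) (compat c (glue u m) && compat d (glue m v)))%N.
  by rewrite /middle -sum1dep_card big_mkcond; apply: eq_bigr => m _; case: (_ && _).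
apply: (@expnI 2 isT).
apply: etrans (esym (card_stack_closure a b)) (etrans _ (card_stack_closure b a)).
rewrite (eq_bigr _ (fun u _ => mE a b u u)) exchange_big /=.
by apply: eq_bigr => m _; rewrite mE; apply: eq_bigr => u _; rewrite andbC.
Qed.

End Closure.

Section Trace.
Variables (F : fieldType) (delta : F) (n : nat).
Implicit Types (a b s : diagram n.+1).
Local Notation P := (partition_algebra delta n.+1).
Local Notation V := (@diagram_vect F delta n.+1).

Definition ptrace (x : P) : F := \sum_a x a * delta ^+ (cycles a).-1.

Lemma ptraceD x y : ptrace (x + y) = ptrace x + ptrace y.
Proof.
by rewrite /ptrace -big_split; apply: eq_bigr => a _; rewrite ffunE mulrDl.
Qed.

Lemma ptraceZ c x : ptrace (c *: x) = c * ptrace x.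
Proof.
by rewrite /ptrace mulr_sumr; apply: eq_bigr => a _; rewrite ffunE mulrA.
Qed.

Lemma ptrace0 : ptrace 0 = 0.
Proof. by rewrite -[0](scale0r 0) ptraceZ mul0r. Qed.

Lemma ptrace_vect a : ptrace (V a) = delta ^+ (cycles a).-1.
Proof.
rewrite /ptrace (bigD1 a) //= ffunE eqxx mul1r big1 ?addr0 // => b ba.
by rewrite ffunE (negPf ba) mul0r.
Qed.

Lemma cycles_gt0 a : (0 < cycles a)%N.
Proof.
have := card_cycles a; case: (cycles a) => // /eqP; rewrite expn0 => /cards1P[g0 E].
have C (k : bool) : [ffun=> k] = g0.
  apply/set1P; rewrite -E inE; apply/compatP => x y _.
  by case: x => i; case: y => j; rewrite /= !ffunE.
by have /ffunP/(_ ord0) := etrans (C true) (esym (C false)); rewrite !ffunE.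
Qed.

Lemma ptrace_mul_vect a b : ptrace (V a * V b) = delta ^+ (join a (flip b)).-1.
Proof.
rewrite mul_diagram_vect ptraceZ ptrace_vect -exprD -loops_cycles.
by rewrite -[in RHS](prednK (cycles_gt0 _)) addnS.
Qed.

Lemma ptrace_sum (I : finType) (f : I -> P) : ptrace (\sum_i f i) = \sum_i ptrace (f i).
Proof. exact: (big_morph ptrace ptraceD ptrace0). Qed.

Lemma ptrace_mul (x : P) b :
  ptrace (x * V b) = \sum_a x a * delta ^+ (join a (flip b)).-1.
Proof.
rewrite [x in LHS]diagram_vect_sum mulr_suml ptrace_sum.
by apply: eq_bigr => a _; rewrite -scalerAl ptraceZ ptrace_mul_vect.
Qed.

Lemma ptrace_vectC (x : P) b : ptrace (x * V b) = ptrace (V b * x).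
Proof.
rewrite ptrace_mul [x in RHS]diagram_vect_sum mulr_sumr ptrace_sum.
by apply: eq_bigr => a _; rewrite -scalerAr ptraceZ ptrace_mul_vect join_flipC.
Qed.

Lemma ptraceC (x y : P) : ptrace (x * y) = ptrace (y * x).
Proof.
rewrite [y]diagram_vect_sum mulr_sumr mulr_suml !ptrace_sum.
apply: eq_bigr => b _; rewrite -scalerAl -scalerAr !ptraceZ.
congr (_ * _); exact: ptrace_vectC.
Qed.

End Trace.

(** * Nondegeneracy of the trace form off the permutations *)

Section BlockCount.
Variable n : nat.
Implicit Types (a b : diagram n) (x y : vertex n).

Lemma nblocks_kdiag (T : finType) (g : vertex n -> T) :
  (nblocks (kdiag g) <= #|g @: [set: vertex n]|)%N.
Proof.
rewrite /nblocks /= /preim_partition /equivalence_partition.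
apply: leq_trans (leq_imset_card (fun k => [set y | k == g y]) _).
apply/subset_leq_card/subsetP => _ /imsetP[x _ ->].
apply/imsetP; exists (g x); first exact: imset_f.
by apply/setP => y; rewrite !inE.
Qed.

Lemma nblocks_lt a b : refines a b -> a != b -> (nblocks b < nblocks a)%N.
Proof.
move=> /refinesP ab nab.
have [cA tA] : cover (blocks a) = [set: vertex n] /\ trivIset (blocks a).
  by case: a {ab nab} => P /= /and3P[/eqP].
have [cB [tB nB]] : cover (blocks b) = [set: vertex n] /\
    (trivIset (blocks b) /\ set0 \notin blocks b).
  by case: b {ab nab} => P /= /and3P[/eqP].
pose f (B : {set vertex n}) : {set vertex n} :=
  if [pick x in B] is Some x then pblock (blocks b) x else set0.
have fE x : f (pblock (blocks a) x) = pblock (blocks b) x.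
  rewrite /f; case: pickP => [y|/(_ x)]; last by rewrite mem_pblock cA inE.
  by move=> /ab xy; apply/eqP; rewrite eq_pblock ?cB ?inE // -/(same_block b y x) same_block_sym.
have im : f @: blocks a = blocks b.
  apply/setP => C; apply/imsetP/idP => [[B Ba ->]|Cb].
    have /set0Pn[x xB] : B != set0 by apply: contraTneq Ba => ->; case: (a) => P /= /and3P[].
    by rewrite -(def_pblock tA Ba xB) fE pblock_mem // cB inE.
  have /set0Pn[x xC] : C != set0 by apply: contraNneq nB => <-.
  exists (pblock (blocks a) x); first by rewrite pblock_mem // cA inE.
  by rewrite fE (def_pblock tB Cb xC).
rewrite /nblocks -im ltn_neqAle leq_imset_card andbT.
apply: contra nab => /imset_injP inj_f; apply/eqP/same_block_inj => x y.
apply/idP/idP => [/ab //|xy].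
have inA z : pblock (blocks a) z \in blocks a by rewrite pblock_mem // cA inE.
rewrite /same_block -eq_pblock ?cA ?inE //; apply/eqP/inj_f => //.
by rewrite !fE; apply/eqP; rewrite eq_pblock ?cB ?inE.
Qed.

End BlockCount.

Section Half.
Variables (h : bool) (n : nat).
Implicit Types (a b s : diagram n.+1) (x y : vertex n.+1).
Local Notation last := (@ord_max n).

Definition half_if a : bool := h ==> half_diagram a.

Lemma half_ifP a : reflect (h -> same_block a (inl last) (inr last)) (half_if a).
Proof. exact: implyP. Qed.

Definition moving : {set 'I_n.+1} := [set i | ~~ (h && (i == last))].

Lemma card_moving : #|moving| = (n.+1 - h)%N.
Proof.
rewrite /moving; case: h => /=.
  rewrite (_ : [set i | _] = [set~ last]) ?cardsC1 ?card_ord ?subn1 //.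
  by apply/setP => i; rewrite !inE.
by rewrite subn0 -[RHS]card_ord; apply: eq_card => i; rewrite inE.
Qed.

(** The diagrams [cube_diagram S] join i with i' exactly for i in S or outside
    [moving]; they form the Boolean interval from the finest diagram to the
    identity among the diagrams satisfying [half_if]. *)
Definition cube_label (S : {set 'I_n.+1}) x : vertex n.+1 :=
  if x is inr i then (if (i \in S) || (i \notin moving) then inl i else inr i) else x.

Definition cube_diagram S := kdiag (cube_label S).

Lemma half_cube S : half_if (cube_diagram S).
Proof.
apply/half_ifP => h1; rewrite same_block_kdiag /= inE h1 eqxx /= orbT.
exact: eqxx.
Qed.

Lemma same_block_cube S x y : same_block (cube_diagram S) x y =
  (x == y) || ((column x == column y) && ((column x \in S) || (column x \notin moving))).
Proof.
rewrite same_block_kdiag; set T := fun i => (i \in S) || (i \notin moving).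
have [eqlr eqrl] : (forall i j, (inl i == inr j :> vertex n.+1) = false) /\
  (forall i j, (inr i == inl j :> vertex n.+1) = false) by [].
have eql i j : (inl i == inl j :> vertex n.+1) = (i == j) by [].
have eqr i j : (inr i == inr j :> vertex n.+1) = (i == j) by [].
case: x => i; case: y => j /=; rewrite -?/(T i) -?/(T j) ?eql ?eqr ?eqlr ?eqrl.
- by case: (i == j).
- case: (i =P j) => [<-|/eqP nij]; first by case: (T i); rewrite ?eqxx ?eqlr.
  by case: (T j); rewrite ?eqlr // eql; apply: negbTE.
- case: (i =P j) => [<-|/eqP nij]; first by case: (T i); rewrite ?eqxx ?eqrl.
  by case: (T i); rewrite ?eqrl // eql; apply: negbTE.
- case: (i =P j) => [->|/eqP nij]; first by rewrite eqxx.
  by case: (T i); case: (T j); rewrite ?eqrl ?eqlr ?eql ?eqr //; apply: negbTE.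
Qed.

Lemma cube_min a : half_if a -> refines (cube_diagram set0) a.
Proof.
move=> /half_ifP ha; apply/refinesP => x y; rewrite same_block_cube inE /=.
case: eqP => [->|_] /=; first by rewrite same_block_refl.
case: x => i; case: y => j /= /andP[/eqP <-]; rewrite inE negbK => /andP[h1 /eqP->];
  rewrite ?same_block_refl ?ha // same_block_sym ha //.
Qed.

Lemma nblocks_cube_min : (nblocks (cube_diagram set0) <= n.+1.*2 - h)%N.
Proof.
apply: leq_trans (nblocks_kdiag _) _.
have card_v : #|[set: vertex n.+1]| = n.+1.*2 by rewrite cardsT card_sum card_ord addnn.
case eh: (h : nat) => [|k].
  by rewrite subn0 -card_v subset_leq_card // subsetT.
have {eh k}[h1 ->] : h /\ k = 0%N by case: h eh => // -[].
rewrite subn1 -card_v (leq_trans (n := #|[set~ (inr last : vertex n.+1)]|)) //; last by rewrite cardsC1 cardsT.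
apply/subset_leq_card/subsetP => _ /imsetP[x _ ->]; rewrite !inE.
case: x => //= i; rewrite inE /= inE negbK h1 /=.
by case: ifP => // /negbT.
Qed.

End Half.

Section Nondegenerate.
Variables (F : fieldType) (delta : F) (h : bool) (n : nat).
Implicit Types (a b s t : diagram n.+1) (x y : vertex n.+1).
Local Notation P := (partition_algebra delta n.+1).
Local Notation V := (@diagram_vect F delta n.+1).
Local Notation cube := (@cube_diagram h n).

Lemma half_refines a b : half_if h a -> refines a b -> half_if h b.
Proof. by move=> /half_ifP ha /refinesP ab; apply/half_ifP => /ha /ab. Qed.

Lemma half_if_flip a : half_if h (flip a) = half_if h a.
Proof. by rewrite /half_if /half_diagram same_block_pull same_block_sym. Qed.

Variable f : P.
Hypothesis f_half : forall a, ~~ half_if h a -> f a = 0.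
Hypothesis f_trace : forall b, half_if h b -> ptrace (f * V b) = 0.
Hypothesis delta_gen : forall k, (0 < k <= n.*2 - h)%N -> delta <> k%:R.

Let lower_sum s := \sum_(a | refines a s) f a.

(** Pairing f with the flip of s gives the sum of these products over all t coarser
    than s, a triangular system solved from the coarsest diagram down. *)
Lemma falling_lower_sum s : half_if h s -> falling delta (nblocks s) * lower_sum s = 0.
Proof.
have [m] := ubnP (#|[set: vertex n.+1 * vertex n.+1]| - coarseness s)%N.
elim: m s => // m IHm s; rewrite ltnS => lem hs.
have : ptrace (f * V (flip s)) = 0 by rewrite f_trace ?half_if_flip.
rewrite ptrace_mul flipK.
under eq_bigr => a _ do rewrite expr_join mulr_sumr.
rewrite (exchange_big_dep (fun t => refines s t)) /=; last by move=> a t _ /andP[].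
rewrite (bigD1 s) ?refines_refl //= [X in _ + X]big1 ?addr0 => [<-|t /andP[st ts]].
  by rewrite mulrC mulr_suml; apply: eq_bigl => a; rewrite andbT.
rewrite (eq_bigl (fun a => refines a t)); last by move=> a; rewrite st andbT.
rewrite -mulr_suml mulrC IHm //; last exact: half_refines hs st.
apply: leq_trans lem; rewrite ltn_sub2l //; last by rewrite coarseness_lt // eq_sym.
apply: leq_trans (coarseness_lt st _) _; first by rewrite eq_sym.
by rewrite subset_leq_card // subsetT.
Qed.

(** A diagram other than the finest one has at most 2n + 1 - h blocks, so no factor of
    its falling factorial vanishes. *)
Lemma lower_sum_eq0 s : half_if h s -> s != cube set0 -> lower_sum s = 0.
Proof.
move=> hs ns; have /eqP := falling_lower_sum hs; rewrite mulf_eq0 => /orP[|/eqP//].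
rewrite /falling prodf_seq_eq0 => /hasP[k]; rewrite mem_index_iota => /andP[k0 kn] /=.
rewrite subr_eq0 => /eqP /delta_gen []; rewrite k0 /=.
have := nblocks_lt (cube_min hs); rewrite eq_sym => /(_ ns) lt.
have := leq_trans lt (nblocks_cube_min h n); move: kn; rewrite doubleS.
by case: (h) => /=; lia.
Qed.

Hypothesis f_id : f (did n.+1) = 0.

(** The lower sums vanish above the finest diagram, so the alternating sum of those
    on the Boolean interval is the coefficient of the finest diagram; by
    Moebius inversion it is also, up to sign, the coefficient of the identity. *)
Lemma f_cube_min : f (cube set0) = 0.
Proof.
(* vanishes unless S contains the complement of moving, so that each diagram of
   the interval is counted once *)
pose c (S : {set 'I_n.+1}) : F :=
  \prod_i (if i \in S then (if i \in moving h n then -1 else 1) else (i \in moving h n)%:R).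
have c0 (S : {set 'I_n.+1}) i : i \notin S -> i \notin moving h n -> c S = 0.
  by move=> iS im; apply/eqP; rewrite /c (bigD1 i) //= (negPf iS) (negPf im) mul0r.
have cube_id S a : refines a (cube S) -> refines a (did n.+1).
  move=> /refinesP aS; apply/refinesP => x y /aS; rewrite same_block_cube same_block_did.
  by case/orP => [/eqP->|/andP[]//]; rewrite eqxx.
have lS (S : {set 'I_n.+1}) : S :&: moving h n != set0 -> lower_sum (cube S) = 0.
  case/set0Pn => i; rewrite inE => /andP[iS im].
  apply: lower_sum_eq0; first exact: half_cube.
  apply: contraTneq isT => E.
  have := same_block_cube h S (inl i) (inr i); rewrite E same_block_cube /=.
  by rewrite iS eqxx /= !inE; move: im; rewrite inE => ->.
have l0 : lower_sum (cube set0) = f (cube set0).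
  rewrite /lower_sum (bigD1 (cube set0)) ?refines_refl //= big1 ?addr0 // => a /andP[ac na].
  apply: f_half; apply: contra na => ha; apply/eqP/same_block_inj => x y.
  by apply/idP/idP; [move/refinesP: ac; apply | move/refinesP: (cube_min ha); apply].
transitivity (\sum_S c S * lower_sum (cube S)).
  rewrite (bigD1 (~: moving h n)) //= big1 ?addr0 => [|S nS].
    have -> : c (~: moving h n) = 1.
      by apply: big1 => i _; rewrite in_setC; case: (i \in moving h n).
    rewrite mul1r -l0; congr lower_sum; apply: same_block_inj => x y.
    by rewrite !same_block_cube in_setC in_set0 orbb.
  case: (boolP (S :&: moving h n == set0)) => [/eqP S0|/lS->]; last by rewrite mulr0.
  have /subsetPn[i] : ~~ (~: moving h n \subset S).
    apply: contra nS => sub; rewrite eqEsubset sub andbT.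
    by rewrite -disjoints_subset -setI_eq0 S0.
  by rewrite in_setC => im iS; rewrite (c0 S i) ?mul0r.
rewrite /lower_sum; under eq_bigr => S _ do rewrite mulr_sumr big_mkcond.
rewrite exchange_big big1 //= => a _.
case: (boolP (half_if h a)) => [/half_ifP ha|na]; last first.
  by apply: big1 => S _; case: ifP; rewrite // f_half ?mulr0.
case: (boolP (refines a (did n.+1))) => [ai|nai]; last first.
  by apply: big1 => S _; case: ifP => // /cube_id; rewrite (negPf nai).
pose tied i := same_block a (inl i) (inr i).
transitivity (f a * \prod_(i < n.+1)
    ((if i \in moving h n then -1 else 1) + ((i \in moving h n) && ~~ tied i)%:R)).
  rewrite bigA_distr mulr_sumr; apply: eq_bigr => S _.
  have raS : refines a (cube S) = [forall i, tied i ==> (i \in S) || (i \notin moving h n)].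
    apply/refinesP/forallP => [H i|H x y xy].
      by apply/implyP => /H; rewrite same_block_cube eqxx.
    have /refinesP/(_ _ _ xy) := ai; rewrite same_block_did same_block_cube => E.
    case: eqP => //= nxy; rewrite E /=; apply: (implyP (H _)).
    case: x y E nxy xy => i [j|j] /= /eqP <- //; rewrite /tied // same_block_sym //.
  rewrite raS; case: forallP => [H|H].
    rewrite mulrC; congr (_ * _); apply: eq_bigr => i _; case: ifP => // iS.
    by have := H i; rewrite iS /=; case: (i \in moving h n); case: (tied i).
  have /existsP[i] : [exists i, ~~ (tied i ==> (i \in S) || (i \notin moving h n))].
    by rewrite -negb_forall; apply/forallP.
  rewrite negb_imply negb_or negbK => /and3P[ti iS im].
  by apply/esym/eqP; rewrite (bigD1 i) //= (negPf iS) ti andbF mul0r mulr0.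
case: (boolP [forall i, tied i]) => [/forallP ta|/forallPn[i ti]].
  suff -> : a = did n.+1 by rewrite f_id mul0r.
  apply: same_block_inj => x y; apply/idP/idP; first by move/refinesP: ai; apply.
  rewrite same_block_did => /eqP.
  by case: x y => i [j|j] /= ->; rewrite ?same_block_refl // -/(tied j) ?ta // same_block_sym; apply: ta.
have im : i \in moving h n.
  by rewrite inE; apply: contra ti => /andP[/ha + /eqP ->].
by rewrite (bigD1 i) //= im ti addNr mul0r mulr0.
Qed.

Lemma trace_nondegenerate : f = 0.
Proof.
have l0 s : half_if h s -> lower_sum s = 0.
  move=> hs; have [->|] := eqVneq s (cube set0); last exact: lower_sum_eq0.
  apply: big1 => a ac; case: (boolP (half_if h a)) => [ha|]; last exact: f_half.
  suff -> : a = cube set0 by exact: f_cube_min.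
  apply: same_block_inj => x y.
  by apply/idP/idP; [move/refinesP: ac; apply | move/refinesP: (cube_min ha); apply].
apply/ffunP => s; rewrite [RHS]ffunE.
have [m] := ubnP (coarseness s); elim: m s => // m IHm s; rewrite ltnS => lem.
case: (boolP (half_if h s)) => [hs|]; last exact: f_half.
have := l0 s hs; rewrite /lower_sum (bigD1 s) ?refines_refl //= big1 ?addr0 //.
move=> a /andP[as' na]; apply: IHm; exact: leq_trans (coarseness_lt as' na) lem.
Qed.

End Nondegenerate.

(** * Spans of diagrams, and permutation diagrams *)

Section Spans.
Variables (F : fieldType) (delta : F) (n : nat).
Implicit Types (a b c : diagram n) (S : pred (diagram n)).
Local Notation V := (@diagram_vect F delta n).
Local Notation P := (partition_algebra delta n).

Definition dspan S : {vspace P} := <<[seq V a | a in S]>>%VS.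

Lemma vect_coord a b : V a b = (b == a)%:R.
Proof. exact: ffunE. Qed.

Lemma coord_sum (I : finType) (Q : pred I) (c : I -> F) (d : I -> diagram n) a :
  (\sum_(i | Q i) c i *: V (d i)) a = \sum_(i | Q i) c i * (a == d i)%:R :> F.
Proof.
by rewrite sum_ffunE; apply: eq_bigr => i _; rewrite ffunE vect_coord.
Qed.

Lemma memv_vect S a : S a -> V a \in dspan S.
Proof. by move=> Sa; apply/memv_span/imageP; exists a. Qed.

Lemma mem_dspan S (x : P) : x \in dspan S <-> (forall a, ~~ S a -> x a = 0).
Proof.
split=> [|x0].
  move/coord_span=> -> a na; rewrite sum_ffunE big1 // => i _.
  rewrite ffunE; suff -> : [seq V a | a in S]`_i a = 0 by apply: mulr0.
  have /imageP[b Sb ->] : [seq V a | a in S]`_i \in [seq V a | a in S].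
    by apply: mem_nth; rewrite size_image.
  by rewrite ffunE; case: eqP => // ab; case/negP: na; rewrite ab.
rewrite (diagram_vect_sum x) rpred_sum // => a _.
by case: (boolP (S a)) => [/memv_vect/rpredZ|/x0->]; rewrite ?scale0r ?mem0v.
Qed.

Lemma dspan_mul S1 S2 S3 :
  (forall a b, S1 a -> S2 b -> S3 (dcomp a b)) ->
  {in dspan S1 & dspan S2, forall x y, x * y \in dspan S3}.
Proof.
move=> S12 x y /mem_dspan x0 /mem_dspan y0.
rewrite (diagram_vect_sum x) (diagram_vect_sum y) mulr_suml rpred_sum // => a _.
rewrite mulr_sumr rpred_sum // => b _; rewrite -scalerAl -scalerAr.
case: (boolP (S1 a)) => [S1a|/x0->]; last by rewrite scale0r mem0v.
case: (boolP (S2 b)) => [S2b|/y0->]; last by rewrite scale0r scaler0 mem0v.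
by rewrite mul_diagram_vect !rpredZ // memv_vect // S12.
Qed.

Lemma dspan_sub S1 S2 : subpred S1 S2 -> (dspan S1 <= dspan S2)%VS.
Proof.
move=> S12; apply/subvP => x /mem_dspan x0; apply/mem_dspan => a na.
by apply: x0; apply: contra na => /S12.
Qed.

Lemma dspan_subv S (U : {vspace P}) : (forall a, S a -> V a \in U) -> (dspan S <= U)%VS.
Proof. by move=> SU; apply/span_subvP => _ /imageP[a Sa ->]; apply: SU. Qed.

End Spans.

Section Permutations.
Variable n : nat.
Implicit Types (a b c d : diagram n) (x y : vertex n).

Definition graph_label (f : 'I_n -> 'I_n) x := match x with inl i => f i | inr k => k end.

Definition fun_diagram f : diagram n := kdiag (graph_label f).

(** Asking that each top vertex be joined to a bottom one and to no other top one is
    enough: the resulting injection of the top row into the bottom row is then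
    onto. *)
Definition is_perm a :=
  [forall i, [exists k, same_block a (inl i) (inr k)]] &&
  [forall i, forall j, same_block a (inl i) (inl j) ==> (i == j)].

Lemma is_permP a : reflect ((forall i, exists k, same_block a (inl i) (inr k)) /\
  (forall i j, same_block a (inl i) (inl j) -> i = j)) (is_perm a).
Proof.
apply: (iffP andP) => -[H1 H2]; split.
- by move=> i; apply/existsP/(forallP H1).
- by move=> i j ij; have /forallP/(_ j)/implyP/(_ ij)/eqP := forallP H2 i.
- by apply/forallP => i; apply/existsP.
by apply/forallP => i; apply/forallP => j; apply/implyP => /H2/eqP.
Qed.

Lemma is_perm_fun (s : {perm 'I_n}) : is_perm (fun_diagram s).
Proof.
apply/is_permP; split=> [i|i j].
  by exists (s i); rewrite same_block_kdiag /=.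
by rewrite same_block_kdiag /= => /eqP/perm_inj.
Qed.

Lemma perm_diagramP a : is_perm a -> exists s : {perm 'I_n}, a = fun_diagram s.
Proof.
case/is_permP => H1 H2; have {}H1 i := sigW (H1 i).
pose f i := sval (H1 i).
have fP i : same_block a (inl i) (inr (f i)) := svalP (H1 i).
have inj_f : injective f.
  move=> i j E; apply: H2; apply: same_block_trans (fP i) _.
  by rewrite E same_block_sym.
pose s := perm inj_f; exists s.
have sP i : same_block a (inl i) (inr (s i)) by rewrite permE.
have lP x : same_block a x (inr (graph_label s x)).
  by case: x => i /=; rewrite ?same_block_refl.
have inj_r k l : same_block a (inr k) (inr l) -> k = l.
  rewrite -[k](permKV s) -[l](permKV s) => kl; congr (s _); apply: H2.
  by apply: same_block_trans (sP _) (same_block_trans kl _); rewrite same_block_sym.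
apply: same_block_inj => x y; rewrite same_block_kdiag; apply/idP/eqP => [xy|E].
  apply: inj_r; apply: same_block_trans (same_block_trans xy (lP y)).
  by rewrite same_block_sym.
by apply: same_block_trans (lP x) _; rewrite E same_block_sym.
Qed.

Lemma fun_diagram_inj (s t : {perm 'I_n}) : fun_diagram s = fun_diagram t -> s = t.
Proof.
move=> E; apply/permP => i; have := same_block_kdiag (graph_label s) (inl i) (inr (s i)).
by rewrite -/(fun_diagram s) E same_block_kdiag /= eqxx => /eqP->.
Qed.

Lemma is_perm_flip a : is_perm (flip a) = is_perm a.
Proof.
suff H b : is_perm b -> is_perm (flip b) by apply/idP/idP => /H; rewrite ?flipK.
case/perm_diagramP => s ->; suff -> : flip (fun_diagram s) = fun_diagram s^-1%g.
  exact: is_perm_fun.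
apply: same_block_inj => x y; rewrite same_block_pull !same_block_kdiag.
have E z : graph_label s (flipv z) = s (graph_label s^-1%g z).
  by case: z => i /=; rewrite ?permKV.
by rewrite !E (inj_eq perm_inj).
Qed.

Lemma dcomp_flip a b : dcomp (flip b) (flip a) = flip (dcomp a b).
Proof.
suff [] : dcomp (flip b) (flip a) = flip (dcomp a b) /\ dloops (flip b) (flip a) = dloops a b by [].
apply: middle_unique => u v; rewrite compat_flip -middle_bool; apply: eq_card => m.
by rewrite !inE !compat_flip andbC.
Qed.

Lemma dcomp_top a b i j : same_block a (inl i) (inl j) -> same_block (dcomp a b) (inl i) (inl j).
Proof.
move=> ij; rewrite same_block_dcomp; apply: connect1.
by rewrite stackE; apply/orP; left; apply/linkP; exists (inl i), (inl j).
Qed.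

Lemma dcomp_bottom a b i j : same_block b (inr i) (inr j) -> same_block (dcomp a b) (inr i) (inr j).
Proof.
move=> ij; rewrite same_block_dcomp; apply: connect1.
by rewrite stackE; apply/orP; right; apply/linkP; exists (inr i), (inr j).
Qed.

Lemma is_perm_dcompl a b : is_perm (dcomp a b) -> is_perm a.
Proof.
case/is_permP => H1 H2; apply/is_permP; split=> [i|i j ij]; last exact/H2/dcomp_top.
have [k] := H1 i; rewrite same_block_dcomp /= => ik; apply/existsP.
case: existsP => // nex; exfalso.
pose reach (x : stack_vertex n) : Prop :=
  if x is inl (inl j) then same_block a (inl i) (inl j) else False.
apply: (@connect_step _ _ reach _ _ ik) => [|x y]; first exact: same_block_refl.
case: x => [[j|//]|//] ij; rewrite stackE => /orP[]/linkP[z [t [zE <- zt]]]; last by case: z zE zt.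
case: z zE zt => // j' [->] {j'}; case: t => l /= jl.
  exact: same_block_trans ij jl.
by case: nex; exists l; apply: same_block_trans ij jl.
Qed.

Lemma is_perm_dcompr a b : is_perm (dcomp a b) -> is_perm b.
Proof. by rewrite -is_perm_flip -dcomp_flip => /is_perm_dcompl; rewrite is_perm_flip. Qed.

(** [pull (on_top f) d] relabels the top row of d along f. *)
Definition on_top (f : 'I_n -> 'I_n) x : vertex n := if x is inl i then inl (f i) else x.

Section FunProducts.
Variables (F : fieldType) (delta : F).
Local Notation V := (diagram_vect delta).

Lemma compat_fun (K : eqType) f (u m : 'I_n -> K) :
  reflect (forall i, u i = m (f i)) (compat (fun_diagram f) (glue u m)).
Proof.
have lE i : same_block (fun_diagram f) (inl i) (inr (f i)) by rewrite same_block_kdiag /=.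
apply: (iffP (compatP _ _)) => [H i|E x y]; first exact: (H _ _ (lE i)).
rewrite same_block_kdiag => /eqP xy.
have gE z : glue u m z = m (graph_label f z) by case: z => //= i.
by rewrite !gE xy.
Qed.

(** The side condition says that every block of d meeting the top row is reached
    by f or meets the bottom row, so that no loop is created. *)
Lemma mul_fun_pull f d :
  (forall k, exists x, same_block d (inl k) (on_top f x)) ->
  V (fun_diagram f) * V d = V (pull (on_top f) d).
Proof.
move=> H; have {}H k := sigW (H k).
pose p k := sval (H k).
have pP k : same_block d (inl k) (on_top f (p k)) := svalP (H k).
pose m (u v : {ffun 'I_n -> bool}) : {ffun 'I_n -> bool} := [ffun k => glue u v (p k)].
apply: (@mul_vect_fun _ _ _ _ _ _ m) => [u v /compatP C|u v w /compat_fun E /compatP C].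
  apply/andP; split.
    apply/compat_fun => i; rewrite ffunE; apply: (C (inl i)).
    by rewrite same_block_pull; apply: pP.
  pose q x : vertex n := match x with inl k => p k | inr k => inr k end.
  have qE x : glue (m u v) v x = glue u v (q x) by case: x => k //=; rewrite ffunE.
  have qP x : same_block d x (on_top f (q x)).
    by case: x => k /=; rewrite ?same_block_refl.
  apply/compatP => x y xy; rewrite !qE; apply: C; rewrite same_block_pull.
  apply: same_block_trans (same_block_trans xy (qP y)).
  by rewrite same_block_sym.
have gE x : glue u v x = glue w v (on_top f x) by case: x => k //=.
split; first by apply/compatP => x y; rewrite same_block_pull !gE => /C.
by apply/ffunP => k; rewrite ffunE gE; apply: (C (inl k)).
Qed.

(** Isolating the top vertex i again after it has been merged with j. *)
Lemma mul_flip_fun_pull i j d :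
  i != j -> (forall x, same_block d (inl i) x -> x = inl i) ->
  let f k := if k == i then j else k in
  V (flip (fun_diagram f)) * V (pull (on_top f) d) = V d.
Proof.
move=> nij alone f.
have Cf (u w : {ffun 'I_n -> bool}) :
    reflect (forall i, w i = u (f i)) (compat (flip (fun_diagram f)) (glue u w)).
  by rewrite compat_flip; apply: compat_fun.
pose m (u v : {ffun 'I_n -> bool}) : {ffun 'I_n -> bool} := [ffun k => u (f k)].
have fE x : x != inl i -> on_top f x = x.
  by case: x => k //=; rewrite /f; case: (k =P i) => [->|//]; rewrite eqxx.
have fj x : on_top f x != inl i.
  by case: x => k //=; rewrite /f; case: (k =P i) => [_|/eqP//]; rewrite eq_sym.
apply: (@mul_vect_fun _ _ _ _ _ _ m) => [u v /compatP C|u v w /Cf E /compatP C].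
  apply/andP; split; first by apply/Cf => k; rewrite ffunE.
  have gE x : glue (m u v) v x = glue u v (on_top f x) by case: x => k //=; rewrite ffunE.
  by apply/compatP => x y; rewrite same_block_pull !gE => /C.
split; last by apply/ffunP => k; rewrite ffunE E.
have gE x : glue w v x = glue u v (on_top f x) by case: x => k //=.
apply/compatP => x y; have [->|nx] := eqVneq x (inl i); first by move/alone->.
have [->|ny] := eqVneq y (inl i); first by rewrite same_block_sym => /alone->.
move=> xy; rewrite -(fE x) // -(fE y) // -!gE.
by apply: C; rewrite same_block_pull !fE.
Qed.

Lemma mul_perm_vect (s t : {perm 'I_n}) :
  V (fun_diagram (s * t)%g) = V (fun_diagram s) * V (fun_diagram t).
Proof.
rewrite mul_fun_pull; last first.
  by move=> k; exists (inl (s^-1%g k)); rewrite /= permKV same_block_refl.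
congr (V _); apply: same_block_inj => x y; rewrite same_block_pull !same_block_kdiag.
have E z : graph_label t (on_top s z) = graph_label (s * t)%g z.
  by case: z => k //=; rewrite permM.
by rewrite !E.
Qed.

Lemma fun_diagram1 : fun_diagram (1%g : {perm 'I_n}) = did n.
Proof.
apply: same_block_inj => x y; rewrite same_block_kdiag same_block_did.
have E z : graph_label (1%g : {perm 'I_n}) z = column z by case: z => k //=; rewrite perm1.
by rewrite !E.
Qed.

End FunProducts.
End Permutations.

(** * The corner isomorphic to the algebra of lower rank *)

Definition map_columns m n (f : 'I_m -> 'I_n) (x : vertex m) : vertex n :=
  match x with inl i => inl (f i) | inr i => inr (f i) end.

Section Fold.
Variable n : nat.
Implicit Types (a b : diagram n.+1) (d : diagram n.+2).
Local Notation last := (@ord_max n.+1).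

Definition squeeze (i : 'I_n.+2) : 'I_n.+1 := inord (minn i n).
Definition spread : 'I_n.+1 -> 'I_n.+2 := widen_ord (leqnSn n.+1).
Definition penult : 'I_n.+2 := spread ord_max.

Lemma spreadK : cancel spread squeeze.
Proof.
move=> i; apply: val_inj; rewrite /= inordK ?ltnS ?geq_minr //.
by apply/minn_idPl; rewrite /spread /= -ltnS; apply: ltn_ord.
Qed.

Lemma squeeze_last : squeeze last = ord_max.
Proof. by apply: val_inj; rewrite /= inordK ?ltnS ?geq_minr //; apply/minn_idPr. Qed.

Lemma squeezeK i : i != last -> spread (squeeze i) = i.
Proof.
move=> ni; apply: val_inj; rewrite /= inordK ?ltnS ?geq_minr //.
apply/minn_idPl; rewrite -ltnS ltn_neqAle -ltnS ltn_ord andbT.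
by apply: contra ni => /eqP E; apply/eqP/val_inj.
Qed.

Lemma penult_last : penult != last.
Proof. by rewrite -val_eqE /= neq_ltn ltnSn. Qed.

Definition fold a : diagram n.+2 := pull (map_columns squeeze) a.
Definition unfold d : diagram n.+1 := pull (map_columns spread) d.

Lemma foldK : cancel fold unfold.
Proof.
move=> a; apply: same_block_inj => x y; rewrite !same_block_pull.
have E z : map_columns squeeze (map_columns spread z) = z by case: z => i /=; rewrite spreadK.
by rewrite !E.
Qed.

Definition folded d :=
  same_block d (inl penult) (inl last) && same_block d (inr penult) (inr last).

Lemma unfoldK d : folded d -> fold (unfold d) = d.
Proof.
case/andP => tl tr; apply: same_block_inj => x y; rewrite !same_block_pull.
have E z : same_block d (map_columns spread (map_columns squeeze z)) z.
  by case: z => i /=; have [->|/squeezeK->] := eqVneq i last;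
    rewrite ?same_block_refl ?squeeze_last.
apply/idP/idP => H.
  by apply: same_block_trans (same_block_trans H (E y)); rewrite same_block_sym.
by apply: same_block_trans (E x) (same_block_trans H _); rewrite same_block_sym.
Qed.

Lemma folded_fold a : folded (fold a).
Proof. by apply/andP; split; rewrite same_block_pull /= squeeze_last spreadK same_block_refl. Qed.

Lemma compat_fold (K : eqType) a (u v : 'I_n.+2 -> K) :
  compat (fold a) (glue u v) =
  [&& compat a (glue (u \o spread) (v \o spread)), u last == u penult & v last == v penult].
Proof.
have /andP[tl tr] := folded_fold a.
have gE x : glue (u \o spread) (v \o spread) x = glue u v (map_columns spread x) by case: x.
apply/compatP/and3P => [H|[/compatP H /eqP ul /eqP vl] x y].
  split; last 2 first.
  - by rewrite (H _ _ tl : u penult = u last).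
  - by rewrite (H _ _ tr : v penult = v last).
  apply/compatP => x y xy; rewrite !gE; apply: H; rewrite -same_block_pull.
  by rewrite -/(unfold _) foldK.
have hE z : glue u v z = glue (u \o spread) (v \o spread) (map_columns squeeze z).
  by case: z => i /=; have [->|/squeezeK->] := eqVneq i last; rewrite // squeeze_last.
by rewrite same_block_pull !hE => /H.
Qed.

(** A middle colouring of two folded diagrams takes equal values on the last two
    columns, so it comes from the shorter row. *)
Lemma middle_fold a b (u v : {ffun 'I_n.+2 -> bool}) :
  u last = u penult -> v last = v penult ->
  middle (fold a) (fold b) u v = middle a b (u \o spread) (v \o spread).
Proof.
move=> ul vl.
pose f (w : {ffun 'I_n.+1 -> bool}) : {ffun 'I_n.+2 -> bool} := [ffun i => w (squeeze i)].
have fs w : f w \o spread =1 w by move=> i; rewrite /= ffunE spreadK.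
have Cg (K : eqType) c (u1 u2 v1 v2 : 'I_n.+1 -> K) :
    u1 =1 u2 -> v1 =1 v2 -> compat c (glue u1 v1) = compat c (glue u2 v2).
  by move=> E1 E2; apply: eq_compat; case=> i /=; rewrite ?E1 ?E2.
rewrite /middle -[RHS](@card_imset _ _ f); last first.
  by move=> w w' /ffunP E; apply/ffunP => i; have := E (spread i); rewrite !ffunE spreadK.
apply: eq_card => w; rewrite inE !compat_fold ul vl !eqxx !andbT.
apply/idP/imsetP => [/and3P[/andP[Ca /eqP wl] Cb _]|[w0]].
  have wE : w = f [ffun i => w (spread i)].
    apply/ffunP => i; rewrite !ffunE.
    by have [->|/squeezeK->//] := eqVneq i last; rewrite squeeze_last.
  exists [ffun i => w (spread i)] => //; rewrite inE.
  have wf : w \o spread =1 [ffun i => w (spread i)] by move=> i; rewrite ffunE.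
  by rewrite -(Cg _ a _ _ _ _ (frefl _) wf) -(Cg _ b _ _ _ _ wf (frefl _)) Ca.
rewrite inE => /andP[Ca Cb] ->; rewrite !ffunE squeeze_last spreadK eqxx !andbT.
by rewrite (Cg _ a _ _ _ _ (frefl _) (fs _)) (Cg _ b _ _ _ _ (fs _) (frefl _)) Ca.
Qed.

Lemma dcomp_fold a b :
  dcomp (fold a) (fold b) = fold (dcomp a b) /\ dloops (fold a) (fold b) = dloops a b.
Proof.
apply: middle_unique => u v; rewrite compat_fold.
case: (u last =P u penult) => [ul|nl]; last first.
  rewrite ?andbF mul0n; apply: eq_card0 => w.
  by rewrite inE !compat_fold (introF eqP nl) /= ?andbF.
case: (v last =P v penult) => [vl|nl]; last first.
  rewrite ?andbF mul0n; apply: eq_card0 => w.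
  by rewrite inE !compat_fold (introF eqP nl) /= ?andbF.
by rewrite /= andbT middle_fold // (card_middle true) card_bool.
Qed.

Lemma half_fold h a : half_if h (fold a) = half_if h a.
Proof. by rewrite /half_if /half_diagram same_block_pull /= squeeze_last. Qed.

End Fold.

Section Corner.
Variables (F : fieldType) (delta : F) (h : bool) (n : nat).
Local Notation P1 := (partition_algebra delta n.+1).
Local Notation P2 := (partition_algebra delta n.+2).
Local Notation B1 := (dspan delta (@half_if h n)).
Local Notation B2 := (dspan delta (@half_if h n.+1)).
Implicit Types (x y : P1).

Definition fold_vect x : P2 := \sum_a x a *: diagram_vect delta (fold a).

Lemma fold_vectD x y : fold_vect (x + y) = fold_vect x + fold_vect y.
Proof. by rewrite /fold_vect -big_split; apply: eq_bigr => a _; rewrite ffunE scalerDl. Qed.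

Lemma fold_vectZ c x : fold_vect (c *: x) = c *: fold_vect x.
Proof. by rewrite /fold_vect scaler_sumr; apply: eq_bigr => a _; rewrite ffunE scalerA. Qed.

Lemma fold_vect_sum (I : finType) (f : I -> P1) : fold_vect (\sum_i f i) = \sum_i fold_vect (f i).
Proof.
have fold_vect0 : fold_vect 0 = 0 by rewrite -[0](scale0r 0) fold_vectZ scale0r.
exact: (big_morph fold_vect fold_vectD fold_vect0).
Qed.

Lemma fold_vect_vect a : fold_vect (diagram_vect delta a) = diagram_vect delta (fold a).
Proof.
rewrite /fold_vect (bigD1 a) //= ffunE eqxx scale1r big1 ?addr0 // => b ba.
by rewrite ffunE (negPf ba) scale0r.
Qed.

Lemma fold_vect_coord x a : fold_vect x (fold a) = x a.
Proof.
rewrite sum_ffunE (bigD1 a) //= !ffunE eqxx big1 ?addr0; first exact: mulr1.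
move=> b ba; rewrite !ffunE (inj_eq (can_inj (@foldK n))) eq_sym (negPf ba).
exact: mulr0.
Qed.

Lemma fold_vect_inj : injective fold_vect.
Proof. by move=> x y E; apply/ffunP => a; rewrite -!fold_vect_coord E. Qed.

Lemma fold_vectM x y : fold_vect (x * y) = fold_vect x * fold_vect y.
Proof.
rewrite [x in LHS]diagram_vect_sum [y in LHS]diagram_vect_sum mulr_suml fold_vect_sum.
rewrite /fold_vect mulr_suml; apply: eq_bigr => a _.
rewrite mulr_sumr -/(fold_vect _) fold_vect_sum mulr_sumr; apply: eq_bigr => b _.
rewrite -!scalerAl -!scalerAr !fold_vectZ; congr (_ *: (_ *: _)).
have [E1 E2] := dcomp_fold a b.
by rewrite !mul_diagram_vect fold_vectZ fold_vect_vect E1 E2.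
Qed.

Lemma fold_vect_half x : x \in B1 -> fold_vect x \in B2.
Proof.
move/mem_dspan => x0; rewrite rpred_sum // => a _.
case: (boolP (half_if h a)) => [ha|/x0->]; last by rewrite scale0r mem0v.
by rewrite rpredZ // memv_vect // half_fold.
Qed.

Definition corner_idem : P2 := fold_vect 1.
Local Notation e := corner_idem.

Lemma corner_idemE : e = diagram_vect delta (fold (did n.+1)).
Proof. exact: fold_vect_vect. Qed.

Lemma corner_idemM : e * e = e.
Proof. by rewrite -fold_vectM mul1r. Qed.

Lemma mul_corner_fold x : e * fold_vect x = fold_vect x.
Proof. by rewrite -fold_vectM mul1r. Qed.

Lemma mul_fold_corner x : fold_vect x * e = fold_vect x.
Proof. by rewrite -fold_vectM mulr1. Qed.

Lemma half_did m : half_if h (did m.+1).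
Proof. by apply/half_ifP => _; rewrite same_block_did. Qed.

Lemma half_dcomp m (a b : diagram m.+1) :
  half_if h a -> half_if h b -> half_if h (dcomp a b).
Proof.
by move=> /half_ifP ha /half_ifP hb; apply/half_ifP => h1; apply: half_diagram_dcomp;
  [apply: ha | apply: hb].
Qed.

Lemma corner_fold_vect (z : P2) : z \in B2 -> exists2 x, x \in B1 & e * z * e = fold_vect x.
Proof.
move/mem_dspan => z0.
pose E := fold (did n.+1).
pose g d := dcomp (dcomp E d) E.
have gf d : folded (g d).
  have /andP[tl tr] := folded_fold (did n.+1).
  by apply/andP; split; [apply/dcomp_top/dcomp_top | apply/dcomp_bottom].
have hg d : half_if h d -> half_if h (g d).
  by move=> hd; rewrite !half_dcomp ?half_fold ?half_did.
pose x : P1 := \sum_d (z d * (delta ^+ dloops E d * delta ^+ dloops (dcomp E d) E)) *: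
  diagram_vect delta (unfold (g d)).
exists x.
  rewrite rpred_sum // => d _; case: (boolP (half_if h d)) => [hd|/z0->].
    by rewrite rpredZ // memv_vect // -half_fold unfoldK ?hg.
  by rewrite mul0r scale0r mem0v.
rewrite {1}(diagram_vect_sum z) corner_idemE mulr_sumr mulr_suml fold_vect_sum.
apply: eq_bigr => d _; rewrite -scalerAr -scalerAl fold_vectZ fold_vect_vect unfoldK //.
rewrite mul_diagram_vect -scalerAl mul_diagram_vect !scalerA.
by rewrite mulrA.
Qed.

Lemma regular_unfold : regular_in B2 -> regular_in B1.
Proof.
move=> reg x xB; have [y yB E] := reg _ (fold_vect_half xB).
have [y0 y0B yE] := corner_fold_vect yB.
exists y0 => //; apply: fold_vect_inj; rewrite !fold_vectM -yE -[RHS]E.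
by rewrite !mulrA mul_fold_corner -!mulrA mul_corner_fold.
Qed.

Lemma corner_regular : regular_in B1 -> {in B2, forall z,
  exists2 y, y \in B2 & (e * z * e) * y * (e * z * e) = e * z * e}.
Proof.
move=> reg z /corner_fold_vect[x xB ->]; have [y yB E] := reg x xB.
by exists (fold_vect y); rewrite ?fold_vect_half // -!fold_vectM E.
Qed.

End Corner.

(** * The ideal of non-permutations and the inductive step *)

Section Forward.
Variables (F : fieldType) (delta : F) (h : bool) (n : nat).
Implicit Types (a b d : diagram n.+1).
Local Notation P := (partition_algebra delta n.+1).
Local Notation V := (@diagram_vect F delta n.+1).
Local Notation B := (dspan delta (@half_if h n)).
Local Notation last := (@ord_max n).

Definition half_nonperm a := half_if h a && ~~ is_perm a.
Definition nonperm_ideal : {vspace P} := dspan delta half_nonperm.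
Local Notation J := nonperm_ideal.

Lemma half_span_mul : {in B &, forall x y, x * y \in B}.
Proof. by apply: dspan_mul => a b; apply: half_dcomp. Qed.

Lemma half_span1 : 1 \in B.
Proof. exact/memv_vect/half_did. Qed.

Lemma nonperm_sub : (J <= B)%VS.
Proof. by apply: dspan_sub => a /andP[]. Qed.

Lemma nonperm_mull : {in B & J, forall x j, x * j \in J}.
Proof.
apply: dspan_mul => a b ha /andP[hb nb]; rewrite /half_nonperm half_dcomp //=.
by apply: contra nb => /is_perm_dcompr.
Qed.

Lemma nonperm_mulr : {in J & B, forall j x, j * x \in J}.
Proof.
apply: dspan_mul => a b /andP[ha na] hb; rewrite /half_nonperm half_dcomp //=.
by apply: contra na => /is_perm_dcompl.
Qed.

Lemma half_fun (f : 'I_n.+1 -> 'I_n.+1) : (h -> f last = last) -> half_if h (fun_diagram f).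
Proof. by move=> fl; apply/half_ifP => h1; rewrite same_block_kdiag /= fl. Qed.

Lemma Sym_fix_last (s : {perm 'I_n.+1}) : s \in Sym (moving h n) -> h -> s last = last.
Proof. by rewrite inE => sM h1; apply: (out_perm sM); rewrite inE h1 eqxx. Qed.

Lemma half_perm (s : {perm 'I_n.+1}) : half_if h (fun_diagram s) = (s \in Sym (moving h n)).
Proof.
apply/idP/idP => [/half_ifP H|/Sym_fix_last]; last exact: half_fun.
rewrite inE; apply/subsetP => i; rewrite !inE; apply: contra => /andP[h1 /eqP->].
by have := H h1; rewrite same_block_kdiag.
Qed.

(** Modulo J the algebra is the group algebra of the permutations of [moving]. *)
Lemma half_span_perm (x : P) : x \in B -> exists c : {perm 'I_n.+1} -> F,
  x - \sum_(s in Sym (moving h n)) c s *: V (fun_diagram s) \in J.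
Proof.
move=> /mem_dspan x0; exists (fun s => x (fun_diagram s)).
apply/mem_dspan => a; rewrite negb_and negbK => na.
rewrite ffunE [X in _ + X]ffunE coord_sum.
have [/perm_diagramP[s ->]|na'] := boolP (is_perm a); last first.
  have ha : ~~ half_if h a by move: na; rewrite (negPf na') orbF.
  rewrite x0 // big1 ?subr0 // => s _; case: eqP => [E|_]; last exact: mulr0.
  by case/negP: na'; rewrite E is_perm_fun.
have E (t : {perm 'I_n.+1}) : (fun_diagram s == fun_diagram t) = (s == t).
  by apply/eqP/eqP => [/fun_diagram_inj|->].
case: (boolP (s \in Sym (moving h n))) => hs.
  rewrite (bigD1 s hs) eqxx mulr1 big1 => [|t /andP[_ ts]].
    by have := subrr (x (fun_diagram s)); rewrite -{2}[x _]addr0.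
  by rewrite E eq_sym (negPf ts) mulr0.
rewrite x0 ?half_perm // big1 ?subr0 // => t ht; rewrite E.
by case: eqP => [st|_]; [rewrite st ht in hs | rewrite mulr0].
Qed.

Lemma regular_of_corner (e : P) :
  e \in J -> (J <= B * <[e]> * B)%VS -> e * e = e ->
  {in B, forall z, exists2 y, y \in B & (e * z * e) * y * (e * z * e) = e * z * e} ->
  (forall k, (0 < k <= n.*2 - h)%N -> delta <> k%:R) ->
  (n.+1 - h)`!%:R != 0 :> F -> regular_in B.
Proof.
move=> eJ Je ee reg gen nG.
apply: (@regular_extension _ _ _ J e (@ptrace F delta n) _
  (Sym_group (moving h n)) (fun s => V (fun_diagram s))).
- exact: half_span1.
- exact: half_span_mul.
- exact: nonperm_sub.
- exact: nonperm_mull.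
- exact: nonperm_mulr.
- exact: eJ.
- exact: Je.
- exact: reg.
- exact: ee.
- exact: ptrace0.
- exact: ptraceC.
- move=> j jJ jt; have /mem_dspan j0 := jJ; apply: (@trace_nondegenerate _ _ h _ j).
  + by move=> a na; apply: j0; rewrite negb_and na.
  + by move=> b hb; apply: jt; apply: memv_vect.
  + exact: gen.
  + by apply: j0; rewrite negb_and negbK -fun_diagram1 is_perm_fun orbT.
- by rewrite fun_diagram1.
- by move=> s hs; apply: memv_vect; rewrite half_perm.
- by move=> s t _ _; apply: mul_perm_vect.
- by rewrite card_Sym card_moving.
- by move=> x; apply: half_span_perm.
Qed.

End Forward.

Section Factor.
Variables (F : fieldType) (delta : F) (h : bool) (n : nat).
Implicit Types (a b d : diagram n.+2).
Local Notation P := (partition_algebra delta n.+2).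
Local Notation V := (@diagram_vect F delta n.+2).
Local Notation B := (dspan delta (@half_if h n.+1)).
Local Notation J := (nonperm_ideal delta h n.+1).
Local Notation e := (corner_idem delta n).
Local Notation last := (@ord_max n.+1).
Local Notation BeB := (B * <[e]> * B)%VS.

Lemma BeB_mull x y : x \in B -> y \in BeB -> x * y \in BeB.
Proof.
move=> xB yI; have : x * y \in (B * BeB)%VS by rewrite memv_mul.
apply: subvP; rewrite !prodvA !prodvSl //; apply/prodvP.
exact: half_span_mul.
Qed.

Lemma mul_corner_vect d : same_block d (inl (penult n)) (inl last) -> e * V d = V d.
Proof.
move=> dl; rewrite corner_idemE.
pose m (u v : {ffun 'I_n.+2 -> bool}) := u.
apply: (@mul_vect_fun _ _ _ _ _ _ m) => [u v C|u v w].
  rewrite C andbT compat_fold /m; have /compatP/(_ _ _ dl) /= -> := C; rewrite !eqxx andbT.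
  by rewrite andbT; apply/compatP => x y; rewrite same_block_did; case: x y => i [j|j] /= /eqP->.
rewrite compat_fold => /and3P[/compatP C /eqP ul /eqP wl] Cd.
suff E : w = u by rewrite -E.
apply/ffunP => i; have [->|/squeezeK <-] := eqVneq i last.
  rewrite ul wl; apply/esym/(C (inl ord_max) (inr ord_max)).
  by rewrite same_block_did.
by apply/esym/(C (inl (squeeze i)) (inr (squeeze i))); rewrite same_block_did.
Qed.

(** If i and j are tied, j can be dropped from the top row: f relabels the row so
    that the last two columns carry the label of the last one and j is missed, and
    g restores the original diagram.  The relabelled diagram absorbs e. *)
Lemma top_tie_BeB a i j : half_if h a -> i != j ->
  same_block a (inl i) (inl j) -> V a \in BeB.
Proof.
wlog jl : i j / j != last => [H ha nij aij|].
  have [jl|jl] := eqVneq j last; last exact: (H i j).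
  by apply: (H j i) => //; rewrite ?(eq_sym j) 1?same_block_sym // -jl.
move=> ha nij aij.
pose t := tperm (penult n) j.
have tl : t last = last by rewrite tpermD // penult_last.
pose f k := if k == penult n then last else t k.
pose g k := if k == j then t i else t k.
have ft k : k != j -> f (t k) = k.
  move=> kj; rewrite /f (_ : (t k == penult n) = false) ?tpermK //.
  by rewrite -(inj_eq (@perm_inj _ t)) tpermK tpermL; apply: negbTE.
have fg k : same_block a (inl (f (g k))) (inl k).
  rewrite /g; have [->|kj] := eqVneq k j; first by rewrite ft.
  by rewrite ft // same_block_refl.
have gl : g last = last by rewrite /g eq_sym (negPf jl).
have fl : f last = last by rewrite /f eq_sym (negPf (penult_last n)).
pose a2 := pull (on_top f) a.
have ha2 : half_if h a2.
  by apply/half_ifP => h1; rewrite same_block_pull /= fl; apply: (half_ifP _ _ ha).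
have Ea : V (fun_diagram g) * V a2 = V a.
  rewrite mul_fun_pull => [|k].
    congr (V _); apply: same_block_inj => x y; rewrite !same_block_pull.
    have E z : same_block a (on_top f (on_top g z)) z.
      by case: z => k /=; rewrite ?same_block_refl.
    apply/idP/idP => H.
      by apply: same_block_trans (same_block_trans H (E y)); rewrite same_block_sym.
    by apply: same_block_trans (E x) (same_block_trans H _); rewrite same_block_sym.
  have [->|kp] := eqVneq k (penult n).
    exists (inl last); rewrite same_block_pull /= gl fl.
    by rewrite /f eqxx same_block_refl.
  exists (inl (t k)); rewrite /= /g (_ : (t k == j) = false) ?tpermK ?same_block_refl //.
  by rewrite -(inj_eq (@perm_inj _ t)) tpermK tpermR; apply: negbTE.
have V2 : V a2 \in BeB.
  rewrite -(@mul_corner_vect a2); last by rewrite same_block_pull /= fl /f eqxx same_block_refl.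
  have := memv_mul (memv_mul (half_span1 delta h n.+1) (memv_line e)) (memv_vect delta ha2).
  by rewrite mul1r.
rewrite -Ea; apply: BeB_mull V2; apply: memv_vect.
exact: half_fun.
Qed.

(** A diagram that is not a permutation ties two top vertices or has an isolated
    top vertex; in the latter case it arises by isolating a vertex of a diagram with a
    tie, without creating a loop. *)
Lemma nonperm_BeB : (J <= BeB)%VS.
Proof.
apply: dspan_subv => a /andP[ha].
rewrite negb_and => /orP[/forallPn[i /existsPn ni]|/forallPn[i /forallPn[j]]]; last first.
  rewrite negb_imply => /andP[aij nij]; exact: top_tie_BeB nij aij.
case: (boolP [exists j, (i != j) && same_block a (inl i) (inl j)]) => [/existsP[j /andP[nij aij]]|].
  exact: top_tie_BeB nij aij.
move/existsPn => alone.
have [j nij] : exists j, i != j.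
  exists (if i == last then penult n else last); have [->|//] := eqVneq i last.
  by rewrite eq_sym penult_last.
have al x : same_block a (inl i) x -> x = inl i.
  case: x => k; last by rewrite (negPf (ni k)).
  by have [->|nk] := eqVneq k i => //; have := alone k; rewrite eq_sym nk /= => /negPf->.
rewrite -(mul_flip_fun_pull delta nij al); set f := (fun k => _).
have fl : h -> f last = last.
  move=> h1; rewrite /f; case: eqP => // il; have := ni last.
  by rewrite -il (half_ifP _ _ ha).
apply: BeB_mull; first by apply: memv_vect; rewrite half_if_flip half_fun.
apply: (@top_tie_BeB _ i j) => //.
  by apply/half_ifP => h1; rewrite same_block_pull /= fl //; apply: (half_ifP _ _ ha).
by rewrite same_block_pull /= /f eqxx eq_sym (negPf nij) same_block_refl.
Qed.

Lemma corner_nonperm : e \in J.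
Proof.
rewrite corner_idemE; apply: memv_vect.
rewrite /half_nonperm half_fold half_did /=; apply/is_permP => -[_ H].
have := penult_last n; rewrite (H (penult n) last) ?eqxx //.
by case/andP: (folded_fold (did n.+1)).
Qed.

Lemma regular_step : regular_in (dspan delta (@half_if h n)) ->
  (forall k, (0 < k <= n.+1.*2 - h)%N -> delta <> k%:R) ->
  (n.+2 - h)`!%:R != 0 :> F -> regular_in B.
Proof.
move=> reg; apply: regular_of_corner.
- exact: corner_nonperm.
- exact: nonperm_BeB.
- exact: corner_idemM.
- exact: corner_regular.
Qed.

End Factor.

(** * Rank one and the generic case *)

Section RankOne.
Variables (F : fieldType) (delta : F) (h : bool).
Local Notation P := (partition_algebra delta 1).
Local Notation V := (@diagram_vect F delta 1).
Local Notation B := (dspan delta (@half_if h 0)).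
Local Notation J := (nonperm_ideal delta h 0).
Implicit Types a b : diagram 1.

Lemma rank1_is_perm a : is_perm a = same_block a (inl ord0) (inr ord0).
Proof.
apply/is_permP/idP => [[H _]|a0]; first by have [k] := H ord0; rewrite (ord1 k).
by split=> [i|i j _]; [exists ord0; rewrite (ord1 i) | rewrite (ord1 i) (ord1 j)].
Qed.

Lemma rank1_nonperm_eq a b : ~~ is_perm a -> ~~ is_perm b -> a = b.
Proof.
rewrite !rank1_is_perm => na nb; apply: same_block_inj => x y.
case: x => i; case: y => j; rewrite (ord1 i) (ord1 j) ?same_block_refl //.
  by rewrite (negPf na) (negPf nb).
by rewrite !(same_block_sym _ (inr _)) (negPf na) (negPf nb).
Qed.

Lemma regular_rank1 : (h || (delta != 0)) -> regular_in B.
Proof.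
case: h => /= [_|d0].
  have J0 : (nonperm_ideal delta true 0 <= 0)%VS.
    apply: dspan_subv => a /andP[/half_ifP/(_ isT) ha].
    by rewrite rank1_is_perm; move: ha; rewrite (ord1 ord_max) => ->.
  apply: (@regular_of_corner _ _ true 0 0).
  - exact: mem0v.
  - exact: subv_trans J0 (sub0v _).
  - exact: mul0r.
  - by move=> z _; exists 0; rewrite ?mem0v // !mul0r.
  - by move=> k; rewrite leqn0 => /andP[k0 /eqP k0']; rewrite k0' in k0.
  - by rewrite oner_eq0.
pose p : diagram 1 := kdiag id.
have np : ~~ is_perm p by rewrite rank1_is_perm same_block_kdiag.
have pap a : V p * V a * V p = delta ^+ (dloops p a + dloops (dcomp p a) p) *: V p.
  rewrite mul_diagram_vect -scalerAl mul_diagram_vect scalerA -exprD; congr (_ *: V _).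
  by apply: rank1_nonperm_eq => //; apply: contra np => /is_perm_dcompr.
pose e := delta^-1 *: V p.
have ee : e * e = e.
  rewrite /e -scalerAl -scalerAr mul_diagram_vect.
  have /middle_unique[-> ->] : forall u v : {ffun 'I_1 -> bool},
      middle p p u v = (compat p (glue u v) * 2 ^ 1)%N.
    have Cp (f : vertex 1 -> bool) : compat p f.
      by apply/compatP => x y; rewrite same_block_kdiag => /eqP->.
    move=> u v; rewrite Cp mul1n /middle.
    rewrite (eq_card (B := predT)) => [|w]; last by rewrite inE !Cp.
    by rewrite card_ffun card_bool card_ord.
  by rewrite expr1 !scalerA -mulrA mulVf // mulr1.
have eJ : e \in nonperm_ideal delta false 0 by rewrite rpredZ // memv_vect // /half_nonperm np.
apply: (@regular_of_corner _ _ false 0 e).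
- exact: eJ.
- apply: dspan_subv => a /andP[_ na]; rewrite (rank1_nonperm_eq na np).
  have -> : V p = 1 * e * (delta *: 1) by rewrite mul1r -scalerAr mulr1 scalerA divff ?scale1r.
  by rewrite memv_mul ?rpredZ ?half_span1 // memv_mul ?memv_line ?half_span1.
- exact: ee.
- move=> z _; have [c Ec] : exists c : F, e * z * e = c *: e.
    exists (delta^-1 * \sum_a z a * delta ^+ (dloops p a + dloops (dcomp p a) p)).
    rewrite /e -!scalerAl -!scalerAr scalerA [in RHS]scalerA.
    have -> : V p * z * V p =
        (\sum_a z a * delta ^+ (dloops p a + dloops (dcomp p a) p)) *: V p.
      rewrite {1}(diagram_vect_sum z) mulr_sumr mulr_suml scaler_suml.
      by apply: eq_bigr => a _; rewrite -scalerAr -scalerAl pap scalerA.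
    by rewrite scalerA mulrAC.
  exists (c^-1 *: e).
    by rewrite rpredZ // (subvP (nonperm_sub delta false 0)).
  rewrite Ec; have [->|c0] := eqVneq c 0; first by rewrite scale0r mulr0.
  have -> : c *: e * (c^-1 *: e) = e by rewrite -scalerAl -scalerAr ee scalerA divff ?scale1r.
  by rewrite -scalerAr ee.
- by move=> k; rewrite leqn0 => /andP[k0 /eqP k0']; rewrite k0' in k0.
- by rewrite oner_eq0.
Qed.

End RankOne.

Lemma fact_neq0_pred (R : nzRingType) m : (m.+1)`!%:R != 0 :> R -> m`!%:R != 0 :> R.
Proof. by rewrite factS natrM; apply: contraNneq => ->; rewrite mulr0. Qed.

Lemma regular_generic (F : fieldType) (delta : F) (h : bool) n :
  (forall k, (h <= k <= n.*2 - h)%N -> delta <> k%:R) ->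
  (n.+1 - h)`!%:R != 0 :> F -> regular_in (dspan delta (@half_if h n)).
Proof.
elim: n => [|n IHn] gen nG.
  apply: regular_rank1; case: h gen {nG} => //= gen.
  by apply/eqP => d0; apply: (gen 0%N).
apply: regular_step => //; last first.
  by move=> k /andP[k0 kn]; apply: gen; rewrite kn andbT (leq_trans _ k0) // leq_b1.
apply: IHn => [k /andP[hk kn]|].
  by apply: gen; rewrite hk (leq_trans kn) // leq_sub2r // leq_double.
by apply: fact_neq0_pred; rewrite -subSn // (leq_trans (leq_b1 h)).
Qed.

(** * Small characteristic *)

Section SmallCharacteristic.
Variables (F : fieldType) (delta : F) (h : bool) (n : nat).
Local Notation V := (@diagram_vect F delta n.+1).
Local Notation B := (dspan delta (@half_if h n)).
Local Notation J := (nonperm_ideal delta h n).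
Local Notation G := (Sym (moving h n)).

(** The sum s of the permutation diagrams satisfies s y s = c s s modulo J, with c a
    scalar, and s s = (n + 1 - h)! s = 0. *)
Lemma not_regular_fact : (n.+1 - h)`!%:R = 0 :> F -> ~ regular_in B.
Proof.
rewrite -card_moving -card_Sym => G0 reg.
pose s := \sum_(g in G) V (fun_diagram g).
have sB : s \in B by rewrite rpred_sum // => g hg; rewrite memv_vect // half_perm.
have Vs g : g \in G -> V (fun_diagram g) * s = s.
  move=> hg; rewrite /s mulr_sumr [RHS](reindex_inj (mulgI g)) /=.
  apply: eq_big => [g'|g' _]; last by rewrite mul_perm_vect.
  by rewrite -[G]/(gval (Sym_group _)) groupMl.
have ss : s * s = 0.
  rewrite {1}/s mulr_suml (eq_bigr (fun=> s)) => [|g /Vs//].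
  by rewrite sumr_const -scaler_nat G0 scale0r.
have [y yB E] := reg s sB; have [c] := half_span_perm yB.
set y0 := \sum_(g in G) _ => yJ.
have sJ : s \in J.
  have -> : s = s * (y - y0) * s.
    rewrite mulrBr mulrBl E; suff -> : s * y0 * s = 0 by rewrite subr0.
    have -> : s * y0 * s = s * ((\sum_(g in G) c g) *: s).
      rewrite -mulrA; congr (_ * _); rewrite /y0 mulr_suml scaler_suml.
      by apply: eq_bigr => g hg; rewrite -scalerAl Vs.
    by rewrite -scalerAr ss scaler0.
  apply: nonperm_mulr => //; exact: nonperm_mull.
move/mem_dspan: sJ => /(_ (fun_diagram (1%g : {perm 'I_n.+1}))).
rewrite negb_and negbK is_perm_fun orbT => /(_ isT) /eqP.
have -> : s = \sum_(g in G) 1 *: V (fun_diagram g) by apply: eq_bigr => g _; rewrite scale1r.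
rewrite coord_sum (bigD1 1%g) ?group1 //= eqxx big1 ?addr0; first by rewrite mulr1 oner_eq0.
move=> g /andP[_ g1]; case: eqP => [/fun_diagram_inj E1|_]; last exact: mulr0.
by rewrite E1 eqxx in g1.
Qed.

End SmallCharacteristic.

(** * The alternating sum of orbit diagrams *)

Section Annihilated.
Variables (F : fieldType) (delta : F) (h : bool) (n t : nat).
Hypothesis tn : (t + h <= n)%N.
Implicit Types (a : diagram n.+1) (x y : vertex n.+1) (g : {perm vertex n.+1}).
Local Notation V := (@diagram_vect F delta n.+1).
Local Notation J := (nonperm_ideal delta h n).
Local Notation last := (@ord_max n).

(** The bottom vertices from t on form one block, represented by [rest], which keeps
    the orbit diagrams away from the permutations; for h true the last one is
    instead attached to its partner in the top row. *)
Definition rest : vertex n.+1 := inr (inord t).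

Definition retract x : vertex n.+1 :=
  match x with
  | inl i => inl i
  | inr k => if (k < t)%N then inr k else if h && (k == last) then inl last else rest
  end.

Definition orbit_support : {set vertex n.+1} :=
  [set x : vertex n.+1 | match x with inl _ => true | inr k => (k < t)%N end].

Lemma inord_t : (inord t : 'I_n.+1) = t :> nat.
Proof. by rewrite inordK // ltnS (leq_trans _ tn) // leq_addr. Qed.

Lemma rest_support : rest \notin orbit_support.
Proof. by rewrite inE /= inord_t ltnn. Qed.

Lemma retract_id x : x \in orbit_support -> retract x = x.
Proof. by rewrite inE; case: x => //= k ->. Qed.

Lemma retract_rest : retract rest = rest.
Proof.
rewrite /= inord_t ltnn; case: ifP => // /andP[h1 /eqP/(congr1 val)] /=.
by rewrite inord_t => E; move: tn; rewrite h1 E addn1 ltnn.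
Qed.

Lemma retract_mem x : (retract x \in orbit_support) || (retract x == rest).
Proof.
case: x => [i|k] /=; first by rewrite inE.
by case: ifP => kt; [rewrite inE kt | case: ifP; rewrite ?inE // eqxx orbT].
Qed.

Lemma retractK x : retract (retract x) = retract x.
Proof.
by have /orP[/retract_id|/eqP->] := retract_mem x; rewrite ?retract_rest.
Qed.

Lemma card_support : #|orbit_support| = (n + t).+1.
Proof.
have -> : orbit_support = [set inl i | i in 'I_n.+1] :|: [set inr k | k in [set k : 'I_n.+1 | (k < t)%N]].
  apply/setP => -[i|k]; rewrite !inE.
    by rewrite imset_f.
  have -> : (inr k \in [set (inl i : vertex n.+1) | i in 'I_n.+1]) = false.
    by apply/imsetP => -[].
  rewrite /= (mem_imset _ _ (_ : injective inr)) ?inE //; by move=> ? ? [].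
rewrite cardsU disjoint_setI0 ?cards0 ?subn0; last first.
  by apply/pred0P => x /=; apply/andP => -[/imsetP[i _ ->] /imsetP[]].
rewrite !card_imset; try by move=> ? ? [].
rewrite card_ord addSn; congr _.+1; congr addn.
have tn1 : (t <= n.+1)%N by rewrite (leq_trans (leq_addr h t)) // (leq_trans tn).
have inj_w : injective (widen_ord tn1) by move=> i j /(congr1 val) E; apply: val_inj.
rewrite -[RHS]card_ord -(card_imset _ inj_w).
apply: eq_card => k; rewrite inE; apply/idP/imsetP => [kt|[i _ ->]]; last exact: (ltn_ord i).
by exists (Ordinal kt) => //; apply: val_inj.
Qed.

Definition orbit_diagram g := kdiag (fun x => porbit g (retract x)).
Local Notation O := orbit_diagram.

Lemma Sym_out g x : g \in Sym orbit_support -> x \notin orbit_support -> g x = x.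
Proof. by rewrite inE => gS; apply: out_perm. Qed.

Lemma Sym_rest g : g \in Sym orbit_support -> g rest = rest.
Proof. by move=> gS; apply: Sym_out gS rest_support. Qed.

(** A colouring is constant on the orbits of g when it is invariant under g. *)
Lemma compat_orbit (K : eqType) g (f : vertex n.+1 -> K) : g \in Sym orbit_support ->
  reflect ((forall x, f (retract x) = f x) /\ (forall x, f (g x) = f x)) (compat (O g) f).
Proof.
move=> gS; apply: (iffP (compatP _ _)) => [H|[Hr Hg] x y].
  have Hr x : f (retract x) = f x by apply: H; rewrite same_block_kdiag retractK.
  split=> // x; have [xS|xS] := boolP (x \in orbit_support); last by rewrite (Sym_out gS).
  apply: H; rewrite same_block_kdiag retract_id; last first.
    by move: gS; rewrite inE => gS; rewrite (perm_closed _ gS).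
  by rewrite retract_id // eq_porbit_mem (mem_porbit g 1).
rewrite same_block_kdiag eq_porbit_mem => /porbitP[i E].
rewrite -(Hr x) -(Hr y) E; elim: i {E} => [|i IH]; first by rewrite perm1.
by rewrite expgSr permM Hg.
Qed.

Definition signed_orbits := \sum_(g in Sym orbit_support) (-1) ^+ g *: V (O g).
Local Notation z := signed_orbits.

Lemma half_orbit g : half_if h (O g).
Proof.
apply/half_ifP => h1; rewrite same_block_kdiag /= h1 eqxx /=.
case: ifP => // nt; move: tn; rewrite h1 addn1 => tn'.
by have := ltn_trans nt tn'; rewrite ltnn.
Qed.

Lemma orbit_nonperm g : g \in Sym orbit_support -> ~~ is_perm (O g).
Proof.
move=> gS; rewrite -is_perm_flip; apply/is_permP => -[H _].
have [k] := H (inord t); rewrite same_block_pull same_block_kdiag retract_rest.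
rewrite eq_porbit_mem porbit_sym => /porbitP[i] /= E.
suff F0 j : (g ^+ j)%g rest = rest by rewrite F0 in E.
by elim: j => [|j IH]; rewrite ?perm1 // expgSr permM IH Sym_rest.
Qed.

Lemma signed_orbits_nonperm : z \in J.
Proof.
rewrite rpred_sum // => g gS; rewrite rpredZ // memv_vect //.
by rewrite /half_nonperm half_orbit orbit_nonperm.
Qed.

Lemma orbit_diagram1 g : g \in Sym orbit_support -> O 1 = O g -> g = 1%g.
Proof.
move=> gS E; apply/permP => x; rewrite perm1.
have [xS|xS] := boolP (x \in orbit_support); last by rewrite (Sym_out gS).
have gxS : g x \in orbit_support by move: gS; rewrite inE => gS; rewrite (perm_closed _ gS).
have : same_block (O g) (g x) x.
  by rewrite same_block_kdiag !retract_id // eq_porbit_mem (mem_porbit g 1).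
rewrite -E same_block_kdiag !retract_id // eq_porbit_mem => /porbitP[i ->].
by rewrite expg1n perm1.
Qed.

Lemma signed_orbits_neq0 : z != 0.
Proof.
apply/eqP => /ffunP/(_ (O 1)); rewrite coord_sum [RHS]ffunE.
rewrite (bigD1 1%g) ?group1 //= odd_perm1 eqxx mul1r big1 => [|g /andP[gS g1]].
  by rewrite addr0 => /eqP; rewrite oner_eq0.
case: eqP => [/(orbit_diagram1 gS) E|_]; last exact: mulr0.
by rewrite E eqxx in g1.
Qed.

Section Alternating.
Variables (U : lmodType F) (Q : {perm vertex n.+1} -> U).

Lemma alternating_sum0 i j : i \in orbit_support -> j \in orbit_support -> i != j ->
  (forall g, g \in Sym orbit_support -> Q (g * tperm i j)%g = Q g) ->
  \sum_(g in Sym orbit_support) (-1) ^+ g *: Q g = 0.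
Proof.
move=> iS jS nij HQ; pose s := tperm i j.
have sS : s \in Sym orbit_support.
  rewrite inE; apply/subsetP => x; rewrite inE /s; case: tpermP => [->|->|_ _]; rewrite ?eqxx //.
rewrite (bigID (fun g : {perm _} => odd_perm g)) /= addrC.
rewrite [X in _ + X](reindex_inj (mulIg s)) /=.
rewrite [X in _ + X](eq_big (fun g => (g \in Sym orbit_support) && ~~ odd_perm g)
  (fun g : {perm _} => - ((-1) ^+ g *: Q g))).
- by rewrite sumrN subrr.
- move=> g; rewrite -[Sym orbit_support]/(gval (Sym_group orbit_support)) groupMr // odd_permM odd_tperm nij.
  by rewrite addbT.
move=> g /andP[]; rewrite -[Sym orbit_support]/(gval (Sym_group orbit_support)) groupMr // => gS.
rewrite odd_permM odd_tperm nij addbT => /negPf ->.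
by rewrite HQ // expr1 scaleN1r expr0 scale1r.
Qed.

(** The permutations sending x0 to x are the products of those fixing x0 with the
    transposition of x0 and x: for x = x0 the term is c q, and each other x
    contributes - q. *)
Lemma rotating_sum0 (c : F) x0 : x0 \in orbit_support ->
  (forall g, g \in Sym orbit_support -> g x0 = x0 -> exists q : U, Q g = c *: q /\
     forall x, x \in orbit_support -> x != x0 -> Q (g * tperm x0 x)%g = q) ->
  c = #|orbit_support|.-1%:R ->
  \sum_(g in Sym orbit_support) (-1) ^+ g *: Q g = 0.
Proof.
move=> x0S HQ cE.
rewrite (partition_big (fun g : {perm _} => g x0) (mem orbit_support)) /=; last first.
  by move=> g; rewrite inE => gS; rewrite (perm_closed _ gS).
have tS x : x \in orbit_support -> tperm x0 x \in Sym orbit_support.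
  by move=> xS; rewrite inE; apply/subsetP => y; rewrite inE; case: tpermP => [->|->|_ _]; rewrite ?eqxx.
transitivity (\sum_(x in orbit_support) \sum_(g in Sym orbit_support | g x0 == x0)
    (-1) ^+ (g * tperm x0 x)%g *: Q (g * tperm x0 x)%g).
  apply: eq_bigr => x xS; rewrite (reindex_inj (mulIg (tperm x0 x))) /=.
  apply: eq_bigl => g; rewrite -[Sym orbit_support]/(gval (Sym_group orbit_support)) groupMr ?tS //.
  by rewrite permM -{2}(tpermL x0 x) (inj_eq perm_inj).
rewrite exchange_big big1 //= => g /andP[gS /eqP gx0].
have [q [Qg Qx]] := HQ g gS gx0.
rewrite (bigD1 x0) //= tperm1 mulg1 Qg.
rewrite (eq_bigr (fun=> - ((-1) ^+ g *: q))) => [|x /andP[xS nx]]; last first.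
  by rewrite Qx // odd_permM odd_tperm eq_sym nx addbT; case: (odd_perm g);
    rewrite ?expr1 ?expr0 ?scaleN1r ?scale1r ?opprK.
have -> : c = (\sum_(x in orbit_support | x != x0) 1)%N%:R.
  rewrite cE sum1_card (cardsD1 x0 orbit_support) x0S /=; congr _%:R.
  by apply: eq_card => x; rewrite in_setD1 andbC.
by rewrite sum1_card sumrN sumr_const scalerA mulrC -scalerA scaler_nat subrr.
Qed.

End Alternating.
End Annihilated.

(** * Non-permutations annihilate the alternating sum *)

Section Annihilation.
Variables (F : fieldType) (delta : F) (h : bool) (n t : nat).
Hypothesis tn : (t + h <= n)%N.
Implicit Types (a : diagram n.+1) (x y : vertex n.+1) (g : {perm vertex n.+1}).
Local Notation V := (@diagram_vect F delta n.+1).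
Local Notation J := (nonperm_ideal delta h n).
Local Notation last := (@ord_max n).
Local Notation bools := {ffun 'I_n.+1 -> bool}.
Local Notation orbit_support := (orbit_support n t).
Local Notation retract := (@retract h n t).
Local Notation O := (orbit_diagram h t).
Local Notation z := (signed_orbits delta h n t).

Lemma tperm_Sym x y : x \in orbit_support -> y \in orbit_support -> tperm x y \in Sym orbit_support.
Proof.
move=> xS yS; rewrite inE; apply/subsetP => v; rewrite inE.
by case: tpermP => [->|->|_ _]; rewrite ?eqxx.
Qed.

Lemma Sym_mul g g' : g \in Sym orbit_support -> g' \in Sym orbit_support -> (g * g')%g \in Sym orbit_support.
Proof. by rewrite -[Sym orbit_support]/(gval (Sym_group orbit_support)); apply: groupM. Qed.

Lemma compat_orbit_tperm (K : eqType) (f : vertex n.+1 -> K) g x y :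
  g \in Sym orbit_support -> x \in orbit_support -> y \in orbit_support -> f x = f y ->
  compat (O (g * tperm x y)%g) f = compat (O g) f.
Proof.
move=> gS xS yS fxy; have gtS := Sym_mul gS (tperm_Sym xS yS).
have ft v : f (tperm x y v) = f v by case: tpermP => // ->.
apply/(compat_orbit tn _ gtS)/(compat_orbit tn _ gS) => -[Hr Hg]; split=> // v.
  by rewrite -[RHS]Hg permM ft.
by rewrite permM ft Hg.
Qed.

Lemma mul_orbit_tied a i j g :
  same_block a (inr i) (inr j) -> g \in Sym orbit_support ->
  V a * V (O (g * tperm (inl i) (inl j))%g) = V a * V (O g).
Proof.
move=> aij gS; rewrite [RHS](_ : _ = delta ^+ 0 *: (V a * V (O g))); last first.
  by rewrite expr0 scale1r.
apply: mul_vect_scale => u v; rewrite expn0 mul1n; apply: eq_card => w.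
rewrite in_set [in RHS]in_set; case: (compatP a (glue u w)) => [C|_]; last by [].
apply: compat_orbit_tperm => //; rewrite ?inE //.
exact: (C _ _ aij).
Qed.

(** If k' is isolated in a and g fixes the top vertex k, the colour of the middle
    vertex k is free, which gives a loop; composing g with the transposition of k and x
    forces that colour to be the one of x, which removes the loop and changes
    nothing else. *)
Lemma mul_orbit_isolated a k g :
  (h -> k != last) -> (forall x, same_block a (inr k) x -> x = inr k) ->
  g \in Sym orbit_support -> g (inl k) = inl k ->
  exists q, V a * V (O g) = delta *: q /\
    forall x, x \in orbit_support -> x != inl k -> V a * V (O (g * tperm (inl k) x)%g) = q.
Proof.
move=> hk alone gS gk.
pose toggle (w : bools) : bools := [ffun i => if i == k then ~~ w i else w i].
have toggleK : involutive toggle.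
  by move=> w; apply/ffunP => i; rewrite !ffunE; case: eqP; rewrite ?negbK.
have Ca (u w : bools) : compat a (glue u w) -> compat a (glue u (toggle w)).
  have E x : x != inr k -> glue u (toggle w) x = glue u w x.
    by case: x => i //= ni; rewrite ffunE; case: (i =P k) ni => // ->; rewrite eqxx.
  move/compatP => C; apply/compatP => x y.
  have [->|nx] := eqVneq x (inr k); first by move/alone->.
  have [->|ny] := eqVneq y (inr k); first by rewrite same_block_sym => /alone->.
  by rewrite !E //; apply: C.
have E (w v : bools) x : x != inl k -> glue (toggle w) v x = glue w v x.
  by case: x => i //= ni; rewrite ffunE; case: (i =P k) ni => // ->; rewrite eqxx.
have Cg (w v : bools) : compat (O g) (glue w v) -> compat (O g) (glue (toggle w) v).
  move/(compat_orbit tn _ gS) => [Hr Hg]; apply/(compat_orbit tn _ gS); split=> x.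
    have [->//|nx] := eqVneq x (inl k).
    rewrite !E //; case: x nx => [i|i] //= _; case: ifP => // _.
    by case: ifP => // /andP[h1 _]; rewrite (inj_eq (@inl_inj _ _)) eq_sym hk.
  have [->|nx] := eqVneq x (inl k); first by rewrite gk.
  by rewrite !E // -gk (inj_eq perm_inj).
have mid (u v : bools) x : x \in orbit_support -> x != inl k ->
    middle a (O g) u v = (2 * middle a (O (g * tperm (inl k) x)%g) u v)%N.
  move=> xS nx.
  have kS : inl k \in orbit_support by rewrite inE.
  have gtS := Sym_mul gS (tperm_Sym kS xS).
  set S := [set w : bools | compat a (glue u w) && compat (O g) (glue w v)].
  have -> : middle a (O (g * tperm (inl k) x)%g) u v =
      #|S :&: [set w : bools | w k == glue w v x]|.
    apply: eq_card => w; rewrite !inE; case: (compat a _) => //=.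
    apply/idP/andP => [Ct|[C /eqP wk]]; last by rewrite compat_orbit_tperm.
    suff wk : w k = glue w v x by rewrite -(compat_orbit_tperm (x := inl k) (y := x)) // Ct wk.
    have [_ Hg] := compat_orbit tn _ gtS Ct.
    by have := Hg (inl k); rewrite permM gk tpermL.
  rewrite /middle -/S -(cardsID [set w : bools | w k == glue w v x] S) mul2n -addnn.
  congr addn; rewrite -[RHS](card_imset _ (inv_inj toggleK)).
  apply: eq_card => w; rewrite !inE; apply/idP/imsetP.
    move=> /andP[wk /andP[C1 C2]]; exists (toggle w); last by rewrite toggleK.
    rewrite !inE Ca // Cg //= E // ffunE eqxx.
    by move: wk; case: (w k); case: (glue w v x).
  case=> w'; rewrite !inE => /andP[/andP[C1 C2] wk] ->.
  rewrite Ca // Cg // E // ffunE eqxx /= andbT.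
  by move: wk; case: (w' k); case: (glue w' v x).
have loops : (0 < dloops a (O g))%N.
  rewrite lt0n; apply/negP => /eqP l0.
  have cst (b : diagram n.+1) : compat b (glue ([ffun=> true] : bools) ([ffun=> true] : bools)).
    by apply/compatP; case=> [i|i] [j|j] _; rewrite /= !ffunE.
  have := middle_bool a (O g) [ffun=> true] [ffun=> true].
  rewrite cst l0 /middle => /eqP /cards1P[w0 /setP Ew].
  have := Ew [ffun=> true]; have := Ew (toggle [ffun=> true]).
  rewrite !inE Ca ?Cg ?cst // => /esym/eqP E1 /esym/eqP E2.
  by have /ffunP/(_ k) := etrans E1 (esym E2); rewrite !ffunE eqxx.
exists (delta ^+ (dloops a (O g)).-1 *: V (dcomp a (O g))); split.
  by rewrite mul_diagram_vect scalerA -exprS prednK.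
move=> x xS nx; apply: mul_vect_middle => u v.
apply/eqP; rewrite -(eqn_pmul2l (isT : 0 < 2)%N) -mid // middle_bool mulnCA -expnS prednK //.
Qed.

Lemma nonperm_mul_signed_orbits a :
  delta = (n + t)%:R -> half_if h a -> ~~ is_perm a -> V a * z = 0.
Proof.
move=> dE ha; rewrite -is_perm_flip => na.
have -> : V a * z = \sum_(g in Sym orbit_support) (-1) ^+ g *: (V a * V (O g)).
  by rewrite /signed_orbits mulr_sumr; apply: eq_bigr => g _; rewrite -scalerAr.
have inlS k : inl k \in orbit_support by rewrite inE.
have tied i j : i != j -> same_block a (inr i) (inr j) ->
    \sum_(g in Sym orbit_support) (-1) ^+ g *: (V a * V (O g)) = 0.
  move=> nij aij; apply: (alternating_sum0 (Q := fun g => V a * V (O g)) (inlS i) (inlS j) nij).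
  by move=> g gS; apply: mul_orbit_tied.
move: na; rewrite negb_and => /orP[/forallPn[k /existsPn nk]|/forallPn[i /forallPn[j]]]; last first.
  by rewrite negb_imply same_block_pull => /andP[aij nij]; apply: (tied i j).
case: (boolP [exists j, (k != j) && same_block a (inr k) (inr j)]).
  by case/existsP => j /andP[nkj akj]; apply: (tied k j).
move/existsPn => nj; apply: (@rotating_sum0 _ _ _ _ _ delta (inl k)) => //; last first.
  by rewrite (card_support tn).
move=> g gS gk; apply: mul_orbit_isolated => //.
  move=> h1; apply/eqP => kl; have := nk last; rewrite same_block_pull /= kl.
  by rewrite same_block_sym (half_ifP _ _ ha).
case=> i; first by have := nk i; rewrite same_block_pull /= => /negPf->.
by have [->//|ni] := eqVneq k i; have := nj i; rewrite ni /= => /negPf->.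
Qed.

(** As z y lies in J for every y, and J z = 0, the product z y z vanishes. *)
Lemma not_regular_delta : delta = (n + t)%:R -> ~ regular_in (dspan delta (@half_if h n)).
Proof.
move=> dE reg; have zJ : z \in J := signed_orbits_nonperm delta tn.
have [y yB E] := reg z (subvP (nonperm_sub delta h n) _ zJ).
have /eqP[] := signed_orbits_neq0 delta h n t; rewrite -E.
have /mem_dspan j0 : z * y \in J by apply: nonperm_mulr.
rewrite (diagram_vect_sum (z * y)) mulr_suml big1 // => a _.
case: (boolP (half_nonperm h a)) => [/andP[ha na]|/j0->]; last by rewrite scale0r mul0r.
by rewrite -scalerAl nonperm_mul_signed_orbits ?scaler0.
Qed.

End Annihilation.

(** For k < n, pass to rank k + 1, where t = 0 applies. *)
Lemma regular_delta (F : fieldType) (delta : F) (h : bool) n k :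
  regular_in (dspan delta (@half_if h n)) -> (h <= k <= n.*2 - h)%N -> delta <> k%:R.
Proof.
move=> reg /andP[hk kn] dk; have [nk|kn'] := leqP n k.
  apply: (@not_regular_delta _ delta h n (k - n)) reg; last by rewrite subnKC.
  by move: kn; rewrite -addnn; lia.
have lower m : regular_in (dspan delta (@half_if h (k + m))) -> regular_in (dspan delta (@half_if h k)).
  by elim: m => [|m IH]; rewrite ?addn0 // addnS => /regular_unfold.
apply: (@not_regular_delta _ delta h k 0); rewrite ?addn0 //.
by apply: (lower (n - k)%N); rewrite subnKC // ltnW.
Qed.

Lemma regular_half_span (F : fieldType) (delta : F) (h : bool) n :
  regular_in (dspan delta (@half_if h n)) <->
  (forall k, (h <= k <= n.*2 - h)%N -> delta <> k%:R) /\ (n.+1 - h)`!%:R != 0 :> F.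
Proof.
split=> [reg|[gen nG]]; last exact: regular_generic.
split=> [k|]; first exact: regular_delta.
by apply/eqP => n0; apply: not_regular_fact n0 reg.
Qed.

Lemma fact_neq0_char (F : fieldType) p r : has_characteristic F p ->
  (r`!%:R != 0 :> F) <-> (p = 0%N \/ (r < p)%N).
Proof.
have prime_dvd q : prime q -> (q %| r`!)%N -> (q <= r)%N.
  move=> q_pr; elim: r => [|m IH]; first by rewrite dvdn1 => /eqP q1; rewrite q1 in q_pr.
  rewrite factS Euclid_dvdM // => /orP[/dvdn_leq->//|/IH/leqW//].
rewrite /has_characteristic; case: eqP => [->|/eqP p0] charF.
  split=> [_|_]; first by left.
  by apply/negP => /(natf0_pchar (fact_gt0 r))[q]; rewrite charF.
have p_pr := pcharf_prime charF; rewrite -(dvdn_pcharf charF).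
split=> [ndvd|[E|rp]]; last 2 first.
- by rewrite E in p0.
- by apply/negP => /(prime_dvd _ p_pr); rewrite leqNgt rp.
by right; rewrite ltnNge; apply: contra ndvd => le_pr; rewrite dvdn_fact // prime_gt0.
Qed.

Theorem theorem4p4 (F : fieldType) (p : nat) (hp : has_characteristic F p)
    (delta : F) (r : nat) (hr : (1 <= r)%N) (half : bool) :
  semisimple (partition_algebra_at delta r half) <->
  (forall k : nat, (half <= k <= 2 * r - 2 + half)%N -> delta <> k%:R) /\
  (p = 0%N \/ (r < p)%N).
Proof.
have -> : semisimple (partition_algebra_at delta r half) <->
    regular_in (dspan delta (@half_if half (r.-1 + half))).
  case: half => /=; last first.
    case: r hr => // r _; rewrite /= addn0 semisimple_regular.
    have fE : dspan delta (@half_if false r) = fullv.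
      by apply/eqP; rewrite eqEsubv subvf /=; apply/subvP => x _; apply/mem_dspan.
    by rewrite fE.
  rewrite addn1 prednK //; exact: regular_subvs.
have -> := regular_half_span delta half (r.-1 + half).
have -> : ((r.-1 + half).+1 - half = r)%N by case: half; lia.
have := fact_neq0_char r hp.
have -> : ((r.-1 + half).*2 - half = 2 * r - 2 + half)%N by case: half; lia.
by move=> ->.
Qed.
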